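(* For $0<r<1$ let $T_r$ be the proper quasi-transformation matrix $$T_{r}=\begin{pmatrix} 0 & \frac{r}{15} & \frac{r}{5} & \frac{r}{15} \\ 0 & \frac{r}{5} & -\frac{r}{15} & \frac{r}{5} \\ 0 & \frac{r}{15} & \frac{r}{5} & \frac{r}{15} \\ 1-r & 0 & 0 & 0 \end{pmatrix},$$ where rows are ordered from bottom to top (so $t_{11}=1-r$ is the bottom-left entry). Then, for every $0<r<1$, the proper quasi-copula $Q_{T_r}$ is not associated with a doubly stochastic signed measure on $[0,1]^2$ and its support $\mathrm{supp}(Q_{T_r})$ is a self-similar set. Moreover, for every $s\in\,]1,2[$ there exists a unique $r\in\,]0,1[$ such that $\dim_{\mathcal{H}}(\mathrm{supp}(Q_{T_r}))=\dim_{\mathcal{B}}(\mathrm{supp}(Q_{T_r}))=s$.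
   Context: Quasi-copulas. A (bivariate) quasi-copula is a function $Q\colon[0,1]^2\to[0,1]$ such that: $Q(t,0)=Q(0,t)=0$ and $Q(t,1)=Q(1,t)=t$ for all $t\in[0,1]$; $Q$ is non-decreasing in each variable; and $|Q(u_1,v_1)-Q(u_2,v_2)|\le|u_1-u_2|+|v_1-v_2|$ for all $u_1,v_1,u_2,v_2\in[0,1]$. For $R=[u_1,u_2]\times[v_1,v_2]\subseteq[0,1]^2$, $V_Q(R)=Q(u_2,v_2)-Q(u_2,v_1)-Q(u_1,v_2)+Q(u_1,v_1)$. A copula is a quasi-copula with $V_Q(R)\ge0$ for every such rectangle $R$; a quasi-copula is proper if it is not a copula. Quasi-transformation matrices. A quasi-transformation matrix is a square matrix $T=(t_{ij})$, $i,j=1,\ldots,m$, with the column index first and the rows ordered from bottom to top (so $t_{ij}$ is the entry in column $i$, counted from the left, and row $j$, counted from the bottom), such that: (a) the sum of all entries is $1$; (b) the sum of the entries in any row or column is positive; (c) the sum of the entries in any submatrix (block of consecutive columns and consecutive rows) that contains at least one entry from the first or last row or column of $T$ is nonnegative. It is proper if some entry is negative. The quasi-copula $Q_T$. Let $p_i$ (resp. $q_j$) be the sum of the entries in the first $i$ columns (resp. first $j$ rows) of $T$, with $p_0=q_0=0$, and $R_{ij}=[p_{i-1},p_i]\times[q_{j-1},q_j]$. For a quasi-copula $Q$, the $T$-transformation $T(Q)$ is the function on $[0,1]^2$ given, for $(u,v)\in R_{ij}$, by $$T(Q)(u,v)=\sum_{i'<i,\,j'<j}t_{i'j'}+\frac{u-p_{i-1}}{p_i-p_{i-1}}\sum_{j'<j}t_{ij'}+\frac{v-q_{j-1}}{q_j-q_{j-1}}\sum_{i'<i}t_{i'j}+t_{ij}\,Q\Bigl(\frac{u-p_{i-1}}{p_i-p_{i-1}},\frac{v-q_{j-1}}{q_j-q_{j-1}}\Bigr)$$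 (empty sums are $0$). It is known that for every quasi-transformation matrix $T$ of order $m\ge2$ there is a unique quasi-copula $Q_T$ with $T(Q_T)=Q_T$, and that $Q_T$ is proper if and only if $T$ is proper. Signed measures. A signed measure on $[0,1]^2$ is an extended real valued, countably additive set function $\mu$ on the Borel sets of $[0,1]^2$ with $\mu(\emptyset)=0$ that assumes at most one of the values $\pm\infty$; it is doubly stochastic if $\mu([0,1]\times A)=\mu(A\times[0,1])=\lambda(A)$ for every Borel set $A\subseteq[0,1]$, where $\lambda$ is Lebesgue measure. A quasi-copula $Q$ is associated with $\mu$ if $\mu(R)=V_Q(R)$ for every rectangle $R=[u_1,u_2]\times[v_1,v_2]\subseteq[0,1]^2$. Support. Let $\mathcal{R}$ be the set of rectangles $I_1\times I_2$ with $I_1,I_2$ open intervals in $[0,1]$ (open in the relative topology of $[0,1]$). A rectangle $R\in\mathcal{R}$ is open $Q$-null if $V_Q(R_1)=0$ for every rectangle $R_1=[a_1,b_1]\times[c_1,d_1]\subset R$. $\mathrm{supp}(Q)$ is the complement in $[0,1]^2$ of the union of all open $Q$-null rectangles. Fractals. A similarity with ratio $c\in\,]0,1[$ is a map $S$ with $d(S(x),S(y))=c\,d(x,y)$ for all $x,y$. A set $E$ is self-similar if $E=\bigcup_{k=1}^m S_k(E)$ for some similarities $S_1,\ldots,S_m$. $\dim_{\mathcal{H}}$ is the Hausdorff dimension; $\dim_{\mathcal{B}}(E)=-\lim_{\delta\to0}\frac{\ln N_\delta(E)}{\ln\delta}$ is the box-counting dimension, where $N_\delta(E)$ is the smallest number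 of sets of diameter at most $\delta$ that cover $E$. *)

(* Defs.v *)
From HB Require Import structures.
From mathcomp Require Import all_boot all_order all_algebra.
From mathcomp Require Import all_classical all_reals all_analysis.

Set Implicit Arguments.
Unset Strict Implicit.
Unset Printing Implicit Defensive.

Import Order.TTheory GRing.Theory Num.Theory.
Import numFieldNormedType.Exports.

Local Open Scope classical_set_scope.
Local Open Scope ring_scope.

(* Functions on [0,1]^2 are represented by total functions R -> R -> R, of which
   only the values on the unit square are ever constrained or used. *)

Section QuasiCopulas.
Context {R : realType}.
Implicit Types (Q : R -> R -> R).

Definition unit_itv : set R := `[0, 1]%classic.
Definition unit_square : set (R * R) := unit_itv `*` unit_itv.

Definition volume Q (u1 u2 v1 v2 : R) : R :=
  Q u2 v2 - Q u2 v1 - Q u1 v2 + Q u1 v1.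

Definition quasi_copula Q : Prop :=
  [/\ forall u v, unit_itv u -> unit_itv v -> unit_itv (Q u v),
      forall t, unit_itv t ->
        [/\ Q t 0 = 0, Q 0 t = 0, Q t 1 = t & Q 1 t = t],
      forall u1 u2 v, unit_itv u1 -> unit_itv u2 -> unit_itv v ->
        u1 <= u2 -> Q u1 v <= Q u2 v /\ Q v u1 <= Q v u2
    & forall u1 v1 u2 v2,
        unit_itv u1 -> unit_itv v1 -> unit_itv u2 -> unit_itv v2 ->
        `|Q u1 v1 - Q u2 v2| <= `|u1 - u2| + `|v1 - v2|].

Definition copula Q : Prop :=
  quasi_copula Q /\
  forall u1 u2 v1 v2, 0 <= u1 -> u1 <= u2 -> u2 <= 1 ->
    0 <= v1 -> v1 <= v2 -> v2 <= 1 -> 0 <= volume Q u1 u2 v1 v2.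

Definition proper_quasi_copula Q : Prop := quasi_copula Q /\ ~ copula Q.

End QuasiCopulas.

Section QuasiTransformationMatrices.
Context {R : realType} {m : nat}.

(* The first index of T is the column (from the left), the second one is the
   row, counted from the bottom; both start at 0. *)
Implicit Types (T : 'M[R]_m) (Q : R -> R -> R).

Definition quasi_transformation T : Prop :=
  [/\ \sum_i \sum_j T i j = 1,
      forall i, 0 < \sum_j T i j,
      forall j, 0 < \sum_i T i j
    & forall i1 i2 j1 j2 : 'I_m, (i1 <= i2)%N -> (j1 <= j2)%N ->
        [|| i1 == 0%N :> nat, i2.+1 == m, j1 == 0%N :> nat | j2.+1 == m] ->
        0 <= \sum_(i < m | (i1 <= i <= i2)%N) \sum_(j < m | (j1 <= j <= j2)%N) T i j].

Definition proper_quasi_transformation T : Prop :=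
  quasi_transformation T /\ exists i j, T i j < 0.

Definition col_sum T (k : nat) : R := \sum_(i < m | (i < k)%N) \sum_j T i j.
Definition row_sum T (k : nat) : R := \sum_(j < m | (j < k)%N) \sum_i T i j.

(* Q' = T(Q) on the unit square *)
Definition is_transform T Q Q' : Prop :=
  forall (i j : 'I_m) (u v : R),
    col_sum T i <= u <= col_sum T i.+1 ->
    row_sum T j <= v <= row_sum T j.+1 ->
    let x := (u - col_sum T i) / (col_sum T i.+1 - col_sum T i) in
    let y := (v - row_sum T j) / (row_sum T j.+1 - row_sum T j) in
    Q' u v = \sum_(i' < m | (i' < i)%N) \sum_(j' < m | (j' < j)%N) T i' j'
             + x * (\sum_(j' < m | (j' < j)%N) T i j')
             + y * (\sum_(i' < m | (i' < i)%N) T i' j)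
             + T i j * Q x y.

Definition fixed_quasi_copula T Q : Prop :=
  quasi_copula Q /\ is_transform T Q Q.

(* Definite description of the quasi-copula fixed by T; the default value 0 is
   not a quasi-copula. *)
Definition QT T : R -> R -> R :=
  xget (fun _ _ => 0)
    [set Q | fixed_quasi_copula T Q /\
             forall Q', fixed_quasi_copula T Q' ->
               forall u v, unit_itv u -> unit_itv v -> Q' u v = Q u v].

End QuasiTransformationMatrices.

(* The literal below lists the rows from top to bottom. *)
Definition Tr {R : realType} (r : R) : 'M[R]_4 :=
  let rows :=
    [:: [:: 0;     r / 15; r / 5;      r / 15];
        [:: 0;     r / 5;  - (r / 15); r / 5];
        [:: 0;     r / 15; r / 5;      r / 15];
        [:: 1 - r; 0;      0;          0]] in
  \matrix_(i, j) nth 0 (nth [::] rows (rev_ord j)) i.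

Section SignedMeasures.
Context {R : realType}.

(* mu is only relevant on the Borel subsets of [0,1]^2. The library's charges
   are finite-valued, hence the explicit definition. *)
Implicit Types mu : set (R * R) -> \bar R.

Definition signed_measure mu : Prop :=
  [/\ mu set0 = 0%E,
      (forall A, measurable A -> A `<=` unit_square -> mu A != +oo%E) \/
      (forall A, measurable A -> A `<=` unit_square -> mu A != -oo%E)
    & forall F : nat -> set (R * R),
        (forall n, measurable (F n)) -> (forall n, F n `<=` unit_square) ->
        trivIset setT F ->
        (\sum_(0 <= i < n) mu (F i))%E @[n --> \oo] --> mu (\bigcup_n F n)].

Definition doubly_stochastic mu : Prop :=
  forall A : set R, measurable A -> A `<=` unit_itv ->
    mu (unit_itv `*` A) = lebesgue_measure A /\
    mu (A `*` unit_itv) = lebesgue_measure A.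

Definition associated (Q : R -> R -> R) mu : Prop :=
  forall u1 u2 v1 v2, 0 <= u1 -> u1 <= u2 -> u2 <= 1 ->
    0 <= v1 -> v1 <= v2 -> v2 <= 1 ->
    mu (`[u1, u2]%classic `*` `[v1, v2]%classic) = (volume Q u1 u2 v1 v2)%:E.

End SignedMeasures.

Section Support.
Context {R : realType}.

Definition relopen_itv (I : set R) : Prop :=
  is_interval I /\ exists2 U : set R, open U & I = U `&` unit_itv.

Definition open_null (Q : R -> R -> R) (I1 I2 : set R) : Prop :=
  [/\ relopen_itv I1, relopen_itv I2
    & forall a1 b1 c1 d1, a1 <= b1 -> c1 <= d1 ->
        `[a1, b1]%classic `*` `[c1, d1]%classic `<=` I1 `*` I2 ->
        volume Q a1 b1 c1 d1 = 0].

Definition supp (Q : R -> R -> R) : set (R * R) :=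
  unit_square `\`
    [set x | exists I1 I2, open_null Q I1 I2 /\ (I1 `*` I2) x].

End Support.

Section Fractals.
Context {R : realType}.
Implicit Types E U : set (R * R).

(* The library's norm on R * R is the maximum norm. *)
Definition eucl_dist (x y : R * R) : R :=
  Num.sqrt ((x.1 - y.1) ^+ 2 + (x.2 - y.2) ^+ 2).

Definition similarity (S : R * R -> R * R) : Prop :=
  exists2 c : R, 0 < c < 1 & forall x y, eucl_dist (S x) (S y) = c * eucl_dist x y.

Definition self_similar E : Prop :=
  exists (m : nat) (S : 'I_m -> R * R -> R * R),
    [/\ (0 < m)%N, forall k, similarity (S k)
      & E = \bigcup_(k in [set: 'I_m]) (S k @` E)].

(* 0 is added to the set so that the empty set has diameter 0. *)
Definition diam U : \bar R :=
  ereal_sup (0%E |` [set (eucl_dist p.1 p.2)%:E | p in U `*` U]).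

(* diam(U)^s, with the convention that the empty set contributes 0 even if
   s = 0 *)
Definition diam_pow (s : R) U : \bar R :=
  if pselect (U = set0) then 0%E else (diam U `^ s)%E.

Definition hausdorff_premeasure (s delta : R) E : \bar R :=
  ereal_inf [set (\sum_(0 <= i <oo) diam_pow s (U i))%E | U in
    [set U : nat -> set (R * R) |
      (forall i, (diam (U i) <= delta%:E)%E) /\ E `<=` \bigcup_i U i]].

Definition hausdorff_measure (s : R) E : \bar R :=
  ereal_sup [set hausdorff_premeasure s delta E | delta in [set d | 0 < d]].

Definition hausdorff_dim E : \bar R :=
  ereal_inf [set s%:E | s in [set s | 0 <= s /\ hausdorff_measure s E = 0%E]].

Definition coverable E (delta : R) (n : nat) : Prop :=
  exists U : 'I_n -> set (R * R),
    (forall i, (diam (U i) <= delta%:E)%E) /\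
    E `<=` \bigcup_(i in [set: 'I_n]) U i.

Definition covering_number E (delta : R) (n : nat) : Prop :=
  coverable E delta n /\ forall k, coverable E delta k -> (n <= k)%N.

(* The box-counting dimension of E exists and equals d. *)
Definition has_box_dim E (d : R) : Prop :=
  exists N : R -> nat,
    (forall delta : R, 0 < delta -> covering_number E delta (N delta)) /\
    - (ln (N delta)%:R / ln delta) @[delta --> 0^'+] --> d.

End Fractals.

(* Main.v *)
Require Import Defs.
From HB Require Import structures.
From mathcomp Require Import all_boot all_order all_algebra.
From mathcomp Require Import all_classical all_reals all_analysis.
From mathcomp Require Import ring lra.

Import Order.TTheory GRing.Theory Num.Theory.
Import numFieldNormedType.Exports.

Local Open Scope classical_set_scope.
Local Open Scope ring_scope.

Set Implicit Arguments.
Unset Strict Implicit.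
Unset Printing Implicit Defensive.

(** The sixteen cells into which the row and column sums of [T_r] divide the
    unit square carry ten nonzero entries, and these sit on squares: one of side
    [1 - r] at the origin and a block of nine of side [r / 3]. All that is to be
    proved about the fixed quasi-copula [Q] rests on one formula. If [phi_i] and
    [psi_j] are the affine coordinates of the columns and rows, made constant
    outside their intervals, then
      T(Q)(u, v) = sum_ij t_ij * Q(phi_i(u), psi_j(v))
    on the whole square ([transform], [transform_cell]). Applied to increments
    it shows that [T] preserves quasi-copulas ([column_itv] is where the sign
    conditions on border blocks enter), and applied to a difference it shows
    that [T] contracts with ratio [max |t_ij| < 1]; hence the fixed point exists
    and is unique ([QT_fixed]). Applied to volumes it says that the image of a
    rectangle in the cell [(i, j)] has [t_ij] times its volume ([volume_cell]),
    and that the volume of any rectangle is the sum of such contributions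
    ([volume_transform]).

    A negative entry therefore makes [Q] proper. It also rules out a signed
    measure: the masses of the cells of order [n] are products of [n] entries,
    so that their absolute values add up to [(sum_ij |t_ij|) ^ n], which is
    unbounded because the entries add up to 1 and one of them is negative,
    whereas a signed measure of finite total mass has finite variation
    ([proper_not_associated]).

    A point is in the support exactly when, for some cell with a nonzero entry,
    it is the image of a point of the support under the affine map onto that cell.
    The support is thus the union of its ten images under these maps
    ([supp_self_similar]), which are similarities as the cells are squares.

    Its dimension is given by Moran's theorem ([self_similar_dimension]), proved
    without constructing a measure. Covers of [E] transported by the cell maps
    show that [C * delta ^ (- s)] sets of diameter [delta] suffice
    ([coverable_powR]). Conversely, let [t < s]. Then the sum of the [t]-th powers
    of the ratios exceeds 1, and its powers leave room to replace each cell of a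
    large order by its copy of the central cell. These copies have gaps between
    them, so that a finite cover by small sets splits into covers of the separate
    pieces, and an induction on the number of sets bounds the sum of the [t]-th
    powers of the diameters from below ([separated_cover_ge], [finite_cover_ge]).
    Compactness extends this to countable covers.

    So the dimension is the root [s] of [(1 - r) ^ s + 9 * (r / 3) ^ s = 1]. For
    [s] between 1 and 2 this equation has exactly one root [r] in [(0, 1)]: one
    exists by the intermediate value theorem, and the convexity of the power
    function excludes a second one ([moran_inj]). *)

(** * Euclidean distance, diameters and finite covers *)

Section EuclideanDistance.
Context {R : realType}.
Implicit Types (x y z : R * R) (U : set (R * R)) (d : R).

Lemma eucl_dist_ge0 x y : 0 <= eucl_dist x y.
Proof. exact: sqrtr_ge0. Qed.

Lemma eucl_dist_sqr x y :
  eucl_dist x y ^+ 2 = (x.1 - y.1) ^+ 2 + (x.2 - y.2) ^+ 2.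
Proof. by rewrite sqr_sqrtr // addr_ge0 ?sqr_ge0. Qed.

Lemma eucl_distC x y : eucl_dist x y = eucl_dist y x.
Proof. by rewrite /eucl_dist -[x.1 - _]opprB -[x.2 - _]opprB !sqrrN. Qed.

Lemma eucl_dist_triangle x y z :
  eucl_dist x z <= eucl_dist x y + eucl_dist y z.
Proof.
have p0 := eucl_dist_ge0 x y; have q0 := eucl_dist_ge0 y z.
have p2 := eucl_dist_sqr x y; have q2 := eucl_dist_sqr y z.
set p := eucl_dist x y in p0 p2 *; set q := eucl_dist y z in q0 q2 *.
rewrite -(ger0_norm (addr_ge0 p0 q0)) -sqrtr_sqr ler_wsqrtr //.
set a := x.1 - y.1 in p2; set b := x.2 - y.2 in p2.
set a' := y.1 - z.1 in q2; set b' := y.2 - z.2 in q2.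
have -> : x.1 - z.1 = a + a' by rewrite /a /a'; ring.
have -> : x.2 - z.2 = b + b' by rewrite /b /b'; ring.
(* Cauchy-Schwarz *)
have cs : a * a' + b * b' <= p * q.
  apply: le_trans (ler_norm _) _; rewrite -(ger0_norm (mulr_ge0 p0 q0)).
  rewrite -!sqrtr_sqr ler_wsqrtr // exprMn p2 q2.
  have := sqr_ge0 (a * b' - b * a'); nra.
nra.
Qed.

Lemma normr1_le_eucl_dist x y : `|x.1 - y.1| <= eucl_dist x y.
Proof. by rewrite -sqrtr_sqr ler_wsqrtr // lerDl sqr_ge0. Qed.

Lemma normr2_le_eucl_dist x y : `|x.2 - y.2| <= eucl_dist x y.
Proof. by rewrite -sqrtr_sqr ler_wsqrtr // lerDr sqr_ge0. Qed.

Lemma eucl_dist_le_norm x y :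
  eucl_dist x y <= `|x.1 - y.1| + `|x.2 - y.2|.
Proof.
rewrite -[leRHS]ger0_norm ?addr_ge0 // -sqrtr_sqr ler_wsqrtr //.
rewrite -(real_normK (num_real (x.1 - y.1))) -(real_normK (num_real (x.2 - y.2))).
have := normr_ge0 (x.1 - y.1); have := normr_ge0 (x.2 - y.2); nra.
Qed.

Lemma eucl_dist_scale (c : R) (o x y : R * R) : 0 <= c ->
  eucl_dist (o.1 + c * x.1, o.2 + c * x.2) (o.1 + c * y.1, o.2 + c * y.2) =
  c * eucl_dist x y.
Proof.
move=> c0; rewrite /eucl_dist /=.
have -> : (o.1 + c * x.1 - (o.1 + c * y.1)) ^+ 2 +
  (o.2 + c * x.2 - (o.2 + c * y.2)) ^+ 2 =
  c ^+ 2 * ((x.1 - y.1) ^+ 2 + (x.2 - y.2) ^+ 2) by ring.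
by rewrite sqrtrM ?sqr_ge0 // sqrtr_sqr ger0_norm.
Qed.

Lemma diam_leP U d :
  (diam U <= d%:E)%E <->
  0 <= d /\ forall x y, U x -> U y -> eucl_dist x y <= d.
Proof.
split=> [/ereal_supP Ud|[d0 Ud]].
  split=> [|x y Ux Uy]; first by rewrite -lee_fin; apply: Ud; left.
  by rewrite -lee_fin; apply: Ud; right; exists (x, y).
apply/ereal_supP => _ [->|[[x y] [/= Ux Uy] <-]]; rewrite lee_fin //.
exact: Ud.
Qed.

Lemma diam_ge0 U : (0 <= diam U)%E.
Proof. by apply: ereal_sup_ubound; left. Qed.

Lemma diam_set0_le d : 0 <= d -> (diam (set0 : set (R * R)) <= d%:E)%E.
Proof. by move=> d0; apply/diam_leP; split. Qed.

Lemma diam_pow_ge0 (t : R) U : (0 <= diam_pow t U)%E.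
Proof. by rewrite /diam_pow; case: pselect => // ?; exact: poweR_ge0. Qed.

Lemma coverable1 (E : set (R * R)) d : 0 <= d ->
  (forall x y, E x -> E y -> eucl_dist x y <= d) -> coverable E d 1.
Proof.
move=> d0 Ed; exists (fun=> E); split=> [_|x Ex]; last by exists ord0.
exact/diam_leP.
Qed.

Lemma coverable_fin (E : set (R * R)) d (J : finType) (U : J -> set (R * R)) :
  (forall j, (diam (U j) <= d%:E)%E) -> E `<=` \bigcup_j U j ->
  coverable E d #|J|.
Proof.
move=> Ud EU; exists (fun i => U (enum_val i)); split=> // x /EU [j _ Ujx].
by exists (enum_rank j) => //; rewrite enum_rankK.
Qed.

Lemma coverable_le (E : set (R * R)) d d' n :
  d <= d' -> coverable E d n -> coverable E d' n.
Proof.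
move=> dd' [U [Ud EU]]; exists U; split=> // i.
by apply: le_trans (Ud i) _; rewrite lee_fin.
Qed.

Lemma coverable_bigcup (E : set (R * R)) (K : finType)
    (S : K -> R * R -> R * R) (c : K -> R) d (n : K -> nat) :
  (forall k, 0 < c k) ->
  (forall k x y, eucl_dist (S k x) (S k y) = c k * eucl_dist x y) ->
  E `<=` \bigcup_k (S k @` E) ->
  (forall k, coverable E (d / c k) (n k)) ->
  coverable E d (\sum_k n k).
Proof.
move=> c0 Sc ES cov.
pose U k := projT1 (cid (cov k)); have UP k := projT2 (cid (cov k)).
have -> : (\sum_k n k)%N = #|{: {k : K & 'I_(n k)}}|.
  rewrite card_tagged sumnE big_map big_enum /=.
  by apply: eq_bigr => k _; rewrite card_ord.
apply: (@coverable_fin _ _ _ (fun j => S (tag j) @` U (tag j) (tagged j))).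
  move=> [k i] /=; have [/(_ i) + _] := UP k.
  move=> /diam_leP [d0 Uki]; apply/diam_leP; split.
    by rewrite pmulr_lge0 ?invr_gt0 in d0.
  move=> _ _ [x Ux <-] [y Uy <-]; rewrite Sc mulrC -ler_pdivlMr //.
  exact: Uki.
move=> _ /ES [k _ [x Ex <-]]; have [_ /(_ x Ex) [i _ Ui]] := UP k.
by exists (Tagged (fun k => 'I_(n k)) i) => //; exists x.
Qed.

End EuclideanDistance.

(** * Self-similar sets and their covers *)

Section SelfSimilarSets.
Context {R : realType}.
Implicit Types (E O : set (R * R)) (K J : finType) (t s : R).

(** Surjectivity lets the points near an image be pulled back. *)
Definition similitude (a : R) (f : R * R -> R * R) : Prop :=
  (forall x y, eucl_dist (f x) (f y) = a * eucl_dist x y) /\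
  forall y, exists x, f x = y.

Lemma powR_ge1 (a s : R) : 1 <= a -> 0 <= s -> 1 <= a `^ s.
Proof. by move=> a1 s0; rewrite -(powRr0 a); exact: ler_powR. Qed.

Lemma powR_lt1 (a t : R) : 0 <= a -> a < 1 -> 0 < t -> a `^ t < 1.
Proof.
move=> a0 a1 t0; have := @gt0_ltr_powR _ t t0 a 1.
by rewrite powR1 !nnegrE ler01; apply.
Qed.

Lemma powR_div (a b t : R) : 0 <= a -> 0 <= b -> (a / b) `^ t = a `^ t / b `^ t.
Proof.
move=> a0 b0; rewrite powRM ?invr_ge0 //; congr (_ * _).
by rewrite -powR_inv1 // -powRrM mulN1r powRN.
Qed.

Lemma pow_small (z e : R) : 0 <= z -> z < 1 -> 0 < e -> exists n, z ^+ n <= e.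
Proof.
move=> z0 z1 e0; have := @cvg_expr _ z; rewrite ger0_norm // => /(_ z1).
move=> /cvgrPdist_le /(_ e e0) [n _ /(_ n (leqnn n))] /=.
by rewrite sub0r normrN ger0_norm ?exprn_ge0 // => zn; exists n.
Qed.

Lemma pow_large (z M : R) : 1 < z -> 0 < M -> exists n, M <= z ^+ n.
Proof.
move=> z1 M0; have z0 : 0 < z by apply: lt_trans z1.
have [||| n zn] := @pow_small z^-1 M^-1.
- by rewrite invr_ge0 ltW.
- by rewrite invf_lt1.
- by rewrite invr_gt0.
by exists n; move: zn; rewrite exprVn lef_pV2 // posrE exprn_gt0.
Qed.

Lemma finite_lower_bound K (c : K -> R) :
  (forall k, 0 < c k) -> exists2 lo, 0 < lo <= 1 & forall k, lo <= c k.
Proof.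
move=> c0; exists (\big[Order.min/1]_k c k); last by move=> k; apply: bigmin_le.
by rewrite lt_bigmin //= bigmin_le_id.
Qed.

Lemma finite_upper_bound K (c : K -> R) :
  (forall k, c k < 1) -> exists2 hi, 0 <= hi < 1 & forall k, c k <= hi.
Proof.
move=> c1; exists (\big[Order.max/0]_k c k); last by move=> k; apply: le_bigmax.
by rewrite bigmax_lt //= bigmax_ge_id.
Qed.

(** Each map [S k] turns a cover of [E] by sets of diameter [delta / c k] into a
    cover of a piece by sets of diameter [delta]. Since the [c k `^ s] add up to at
    most 1, the bound [(C / delta) `^ s] passes from larger to smaller diameters;
    it starts with a single set, at diameters between [D] and [C]. *)
Lemma coverable_powR K (S : K -> R * R -> R * R) (c : K -> R) E (D s : R) :
  (forall k, 0 < c k < 1) -> (forall k, similitude (c k) (S k)) ->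
  E `<=` \bigcup_k (S k @` E) ->
  0 < D -> (forall x y, E x -> E y -> eucl_dist x y <= D) ->
  0 <= s -> \sum_k c k `^ s <= 1 ->
  exists2 C, 0 < C & forall delta, 0 < delta <= D ->
    exists2 n, coverable E delta n & n%:R <= (C / delta) `^ s.
Proof.
move=> c01 Ssim ES D0 ED s0 cs1.
have c0 k : 0 < c k by case/andP: (c01 k).
have [lo /andP[lo0 lo1] loc] := finite_lower_bound c0.
have [hi /andP[hi0 hi1] chi] := @finite_upper_bound _ c (fun k => proj2 (andP (c01 k))).
have C0 : 0 < D / lo by rewrite divr_gt0.
have DC : D <= D / lo by rewrite ler_pdivlMr // ler_piMr // ltW.
exists (D / lo) => // delta /andP[delta0 deltaD].
have [m] := @pow_small hi (delta / D) hi0 hi1 (divr_gt0 delta0 D0).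
rewrite ler_pdivlMr // mulrC => hm.
have {deltaD} dC : delta <= D / lo by apply: le_trans DC.
have one d : D <= d -> coverable E d 1.
  move=> Dd; apply: coverable1 => [|x y Ex Ey]; first exact: ltW (lt_le_trans D0 Dd).
  exact: le_trans (ED _ _ Ex Ey) Dd.
have one_le d : 0 < d -> d <= D / lo -> 1%:R <= (D / lo / d) `^ s.
  by move=> d0 dle; rewrite powR_ge1 // ler_pdivlMr // mul1r.
elim: m delta delta0 hm dC => [|m IH] delta delta0 hm dC.
all: have [Dd|dD] := leP D delta; first by exists 1%N; [exact: one | exact: one_le].
  by move: hm; rewrite expr0 mulr1 leNgt dD.
have cov k : exists n, coverable E (delta / c k) n /\
    n%:R <= (D / lo / (delta / c k)) `^ s.
  have [|||n ? ?] := IH (delta / c k); last by exists n.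
  - by rewrite divr_gt0.
  - rewrite ler_pdivlMr //; apply: le_trans hm.
    by rewrite exprSr mulrA ler_wpM2l // mulr_ge0 ?exprn_ge0 // ltW.
  - rewrite ler_pdivrMr //; apply: le_trans (ltW dD) _.
    by rewrite mulrAC ler_pdivlMr // ler_wpM2l // ltW.
have [n nP] := choice cov.
exists (\sum_k n k)%N.
  apply: (@coverable_bigcup _ _ _ S c) => // k; first by have [] := Ssim k.
  by have [] := nP k.
rewrite natr_sum; apply: (@le_trans _ _ (\sum_k (D / lo / delta) `^ s * c k `^ s)).
  apply: ler_sum => k _; have [_ /le_trans] := nP k; apply.
  have e0 : 0 <= D / lo / delta by exact/ltW/divr_gt0.
  by rewrite invf_div mulrA mulrAC (powRM _ e0 (ltW (c0 k))).
by rewrite -mulr_sumr ler_piMr // powR_ge0.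
Qed.

(** A set of diameter less than the gap meets one piece only, so that a finite
    cover splits into strictly smaller covers of the pieces; magnified back to
    covers of [E], they are bounded from below by induction on the number of
    sets, and the weights [rho j `^ t] add up the bounds without loss. *)
Lemma separated_cover_ge J (f : J -> R * R -> R * R) (rho : J -> R) E t eta :
  0 < t -> 0 < eta -> E !=set0 -> (forall j, 0 < rho j < 1) ->
  (forall j x y, eucl_dist (f j x) (f j y) = rho j * eucl_dist x y) ->
  (forall j x, E x -> E (f j x)) ->
  (forall i j x y, E x -> E y -> i != j -> eta <= eucl_dist (f i x) (f j y)) ->
  1 <= \sum_j rho j `^ t ->
  forall n (A : {set 'I_n}) (U : 'I_n -> set (R * R)) (d : 'I_n -> R),
    (forall i, i \in A ->
      0 <= d i /\ forall x y, U i x -> U i y -> eucl_dist x y <= d i) ->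
    E `<=` \bigcup_(i in [set i | i \in A]) U i ->
    eta `^ t <= \sum_(i in A) d i `^ t.
Proof.
move=> t0 eta0 [x0 Ex0] rho01 frho fE fgap sum1 n A.
have rho0 j : 0 < rho j by case/andP: (rho01 j).
have [m] := ubnP #|A|; elim: m A => // m IH A; rewrite ltnS => Am U d Ud EU.
have [[i [iA di]]|small] := pselect (exists i, i \in A /\ eta <= d i).
  rewrite (bigD1 i) //= -[leLHS]addr0 lerD ?sumr_ge0 //.
    by rewrite ge0_ler_powR ?nnegrE // ltW // (lt_le_trans eta0).
  by move=> k _; exact: powR_ge0.
have {}small i : i \in A -> d i < eta.
  by move=> iA; rewrite ltNge; apply/negP => di; apply: small; exists i.
pose hit j i := `[< exists2 x, E x & U i (f j x) >].
have hit_uniq i j l : i \in A -> hit j i -> hit l i -> j = l.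
  move=> iA /asboolP[x Ex Ux] /asboolP[y Ey Uy].
  apply/eqP/negPn/negP => jl; have := small i iA; rewrite ltNge => /negP; apply.
  by apply: le_trans (fgap _ _ _ _ Ex Ey jl) _; have [_] := Ud i iA; apply.
(* a single ratio has a power less than 1 *)
have two (j : J) : exists l, j != l.
  apply: contrapT => none; move: sum1; rewrite (big_pred1 j) => [|l]; last first.
    by apply/esym/eqP/eqP/negPn/negP => lj; apply: none; exists l; rewrite eq_sym.
  by apply/negP; rewrite -ltNge powR_lt1 ?ltW //; case/andP: (rho01 j).
pose B j := [set i in A | hit j i]%SET.
have IHj j : rho j `^ t * eta `^ t <= \sum_(i in B j) d i `^ t.
  have BA : (#|B j| < m)%N.
    apply: leq_trans Am; apply: proper_card; apply/properP.
    split; first by apply/fintype.subsetP => i; rewrite inE => /andP[].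
    have [l jl] := two j; have [i iA Ui] := EU _ (fE l _ Ex0).
    exists i => //; rewrite inE iA /=; apply/negP => ij.
    move/negP: jl; apply; apply/eqP; apply: (hit_uniq i) => //.
    by apply/asboolP; exists x0.
  have := IH (B j) BA (fun i => f j @^-1` U i) (fun i => d i / rho j).
  have -> : \sum_(i in B j) (d i / rho j) `^ t =
            (\sum_(i in B j) d i `^ t) / rho j `^ t.
    rewrite mulr_suml; apply: eq_bigr => i; rewrite inE => /andP[iA _].
    by have [di0 _] := Ud i iA; rewrite powR_div // ltW.
  rewrite ler_pdivlMr ?powR_gt0 // mulrC; apply.
    move=> i; rewrite inE => /andP[iA _]; have [d0 Ui] := Ud i iA.
    split; first by rewrite divr_ge0 // ltW.
    by move=> x y Ux Uy; rewrite ler_pdivlMr // mulrC -frho; exact: Ui.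
  move=> x Ex; have [i /= iA Ui] := EU _ (fE j _ Ex).
  by exists i => //=; rewrite inE iA; apply/asboolP; exists x.
rewrite -[leLHS]mul1r; apply: (@le_trans _ _ (\sum_j rho j `^ t * eta `^ t)).
  by rewrite -mulr_suml ler_wpM2r // powR_ge0.
apply: le_trans (ler_sum _ (fun j _ => IHj j)) _.
rewrite (exchange_big_dep (mem A)) /= => [|j i _]; last first.
  by rewrite inE => /andP[].
apply: ler_sum => i iA.
have [[j ij]|none] := pselect (exists j, hit j i).
  rewrite (big_pred1 j) // => l; rewrite inE iA /=.
  by apply/idP/eqP => [il|->//]; apply: (hit_uniq i).
rewrite big_pred0 ?powR_ge0 // => j; rewrite inE iA /=.
by apply/negbTE/negP => ij; apply: none; exists j.
Qed.

(** The open set condition, with the ratio 1 allowed so that the identity is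
    the empty iteration. *)
Definition packing E O J (f : J -> R * R -> R * R) (rho : J -> R) : Prop :=
  [/\ forall j, 0 < rho j <= 1 /\ similitude (rho j) (f j),
      forall j x, E x -> E (f j x),
      forall j x, O x -> O (f j x)
    & forall i j x y, O x -> O y -> f i x = f j y -> i = j].

Lemma similitude_inj a f : 0 < a -> similitude a f -> injective f.
Proof.
move=> a0 [fa _] x y fxy; have := fa x y.
have dzz z : eucl_dist z z = 0 :> R.
  by rewrite /eucl_dist !subrr expr0n /= addr0 sqrtr0.
rewrite fxy dzz => /esym/eqP; rewrite mulf_eq0 gt_eqF //= => /eqP xy.
have := normr1_le_eucl_dist x y; have := normr2_le_eucl_dist x y.
rewrite xy !normr_le0 !subr_eq0 => /eqP e2 /eqP e1.
by rewrite [x]surjective_pairing e1 e2 -surjective_pairing.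
Qed.

Lemma packing_comp E O K J (S : K -> R * R -> R * R) c (f : J -> R * R -> R * R) rho :
  packing E O S c -> packing E O f rho ->
  packing E O (fun (p : K * J) x => S p.1 (f p.2 x)) (fun p => c p.1 * rho p.2).
Proof.
move=> [Sc SE SO Sdisj] [frho fE fO fdisj]; split.
- move=> [k j] /=; have [/andP[c0 c1] [kc kS]] := Sc k.
  have [/andP[r0 r1] [jr jf]] := frho j; split.
    by rewrite mulr_gt0 //= mulr_ile1 // ltW.
  split=> [x y|y]; first by rewrite kc jr mulrA.
  by have [z <-] := kS y; have [x <-] := jf z; exists x.
- by move=> [k j] x Ex /=; exact/SE/fE.
- by move=> [k j] x Ox /=; exact/SO/fO.
- move=> [k j] [k' j'] x y Ox Oy /= kj.
  have kk' := Sdisj _ _ _ _ (fO j _ Ox) (fO j' _ Oy) kj; subst k'.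
  have [/andP[c0 _] /(similitude_inj c0) kinj] := Sc k.
  by rewrite (fdisj j j' x y Ox Oy (kinj _ _ kj)).
Qed.

Lemma packing_iter E O K (S : K -> R * R -> R * R) c t n :
  packing E O S c -> exists J (f : J -> R * R -> R * R) rho,
    packing E O f rho /\ \sum_j rho j `^ t = (\sum_k c k `^ t) ^+ n.
Proof.
move=> Spack; elim: n => [|n [J [f [rho [fpack fsum]]]]].
  exists unit, (fun _ x => x), (fun=> 1); split; last first.
    by rewrite (big_pred1 tt) ?powR1 // => -[].
  split=> // [_|[] [] //]; rewrite ltr01 lexx; split=> //.
  by split=> [x y|y]; [rewrite mul1r|exists y].
exists (K * J)%type, (fun p x => S p.1 (f p.2 x)), (fun p => c p.1 * rho p.2).
split; first exact: (packing_comp Spack fpack).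
rewrite exprS -fsum -(pair_big xpredT xpredT (fun k j => (c k * rho j) `^ t)) /=.
rewrite mulr_suml; apply: eq_bigr => k _; rewrite mulr_sumr.
apply: eq_bigr => j _; have [Sc _ _ _] := Spack; have [frho _ _ _] := fpack.
by rewrite powRM // ltW //; [have [/andP[]] := Sc k | have [/andP[]] := frho j].
Qed.

(** For [t] below the similarity dimension the sum of the [c k `^ t] exceeds 1,
    and its powers make up for the loss of replacing every cell of a large
    order by its subcell [k0]; these subcells have gaps between them. *)
Lemma finite_cover_ge E O K (S : K -> R * R -> R * R) c t (k0 : K) r0 :
  packing E O S c -> (forall k, c k < 1) -> E !=set0 ->
  0 < r0 -> (forall x y, E x -> eucl_dist (S k0 x) y < r0 -> O y) ->
  0 < t -> 1 < \sum_k c k `^ t ->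
  exists2 eta, 0 < eta &
    forall n (U : 'I_n -> set (R * R)) (d : 'I_n -> R),
    (forall i, 0 <= d i /\ forall x y, U i x -> U i y -> eucl_dist x y <= d i) ->
    E `<=` \bigcup_i U i -> eta <= \sum_i d i `^ t.
Proof.
move=> Spack c1 E0 r00 inO t0 sum1.
have [Sc SE _ _] := Spack.
have [/andP[ck0 _] [Sk0 _]] := Sc k0.
have [n nP] := pow_large sum1 (powR_gt0 (- t) ck0).
have [J [f [rho [[frho fE fO fdisj] fsum]]]] := packing_iter t n Spack.
have rho0 j : 0 < rho j by have [/andP[]] := frho j.
have [lo /andP[lo0 _] lorho] := finite_lower_bound rho0.
have eta0 : 0 < lo * r0 by rewrite mulr_gt0.
exists ((lo * r0) `^ t) => [|N U d Ud EU]; first exact: powR_gt0.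
have := @separated_cover_ge J (fun j x => f j (S k0 x)) (fun j => rho j * c k0) E t
  (lo * r0) t0 eta0 E0.
have -> : \sum_(i < N) d i `^ t = \sum_(i in [set: 'I_N]%SET) d i `^ t.
  by apply: eq_bigl => i; rewrite inE.
apply=> //.
- move=> j; rewrite mulr_gt0 //=; apply: le_lt_trans (c1 k0).
  by have [/andP[_ r1] _] := frho j; rewrite ler_piMl // ltW.
- by move=> j x y; have [_ [-> _]] := frho j; rewrite Sk0 mulrA.
- by move=> j x Ex; exact/fE/SE.
(* the points within lo * r0 of the image of one subcell are in the open cell
   around it, which is disjoint from the other cells *)
- move=> i j x y Ex Ey ij; rewrite leNgt; apply/negP => close.
  have [_ [frhoi /(_ (f j (S k0 y)))[z fz]]] := frho i.
  move: close; rewrite -fz frhoi => close.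
  have Oz : O z.
    apply: (inO x) => //; rewrite -(ltr_pM2l (rho0 i)).
    by apply: lt_le_trans close _; rewrite ler_pM2r.
  have OSy : O (S k0 y).
    apply: (inO y) => //.
    by rewrite /eucl_dist !subrr expr0n /= addr0 sqrtr0.
  by move/negP: ij; apply; apply/eqP; apply: (fdisj i j z (S k0 y)).
- under eq_bigr => j _ do rewrite powRM ?ltW //.
  by rewrite -mulr_suml fsum -ler_pdivrMr ?powR_gt0 // mul1r -powRN.
- by move=> x /EU [i _ Ui]; exists i => //=; rewrite inE.
Qed.

End SelfSimilarSets.

(** * Hausdorff and box-counting dimension *)

Section FractalDimensions.
Context {R : realType}.
Implicit Types (E : set (R * R)) (s t : R).

(** The two estimates of covers that determine both dimensions: an upper bound
    for the number of sets of a given diameter, and a lower bound, with an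
    arbitrarily small loss in the exponent, for the size of finite covers. *)
Definition economical_covers E s : Prop :=
  exists D C : R, [/\ 0 < D, 0 < C & forall delta, 0 < delta <= D ->
    exists2 n, coverable E delta n & n%:R <= (C / delta) `^ s].

Definition thick_covers E s : Prop :=
  forall t, 0 < t -> t < s -> exists2 eta, 0 < eta &
    forall n (U : 'I_n -> set (R * R)) (d : 'I_n -> R),
    (forall i, 0 <= d i /\ forall x y, U i x -> U i y -> eucl_dist x y <= d i) ->
    E `<=` \bigcup_i U i -> eta <= \sum_i d i `^ t.

Lemma hausdorff_premeasure_coverable E t delta n : 0 < t -> 0 <= delta ->
  coverable E delta n ->
  (hausdorff_premeasure t delta E <= (n%:R * delta `^ t)%:E)%E.
Proof.
move=> t0 delta0 [U [Ud EU]].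
(* the finite cover is continued by empty sets, which contribute nothing *)
pose V i : set (R * R) := if insub i is Some j then U j else set0.
have V0 i : (n <= i)%N -> V i = set0.
  by move=> ni; rewrite /V insubN // -leqNgt.
have Vd i : (diam (V i) <= delta%:E)%E.
  by rewrite /V; case: insub => [j|]; [exact: Ud | exact: diam_set0_le].
have pow0 : diam_pow t (set0 : set (R * R)) = 0%E.
  by rewrite /diam_pow; case: pselect.
apply: (@le_trans _ _ (\sum_(0 <= i <oo) diam_pow t (V i))%E).
  apply: ereal_inf_lbound; exists V => //; split=> // x /EU [i _ Ui].
  by exists (val i) => //; rewrite /V valK.
rewrite (nneseries_split 0 n) => [|i _]; last exact: diam_pow_ge0.
rewrite add0n eseries0 ?adde0 => [|i ni _]; last by rewrite V0.
apply: (@le_trans _ _ (\sum_(0 <= i < n) (delta `^ t)%:E)%E); last first.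
  by rewrite sumEFin sumr_const_nat subn0 mulr_natl.
apply: lee_sum => i _; rewrite /diam_pow; case: pselect => [?|?].
  by rewrite lee_fin powR_ge0.
rewrite -poweR_EFin; apply: gt0_ler_poweR => //; first exact: ltW.
  by rewrite in_itv /= leey andbT diam_ge0.
by rewrite in_itv /= leey andbT lee_fin.
Qed.

Lemma hausdorff_measure_eq0 E s t :
  0 < s -> s < t -> economical_covers E s -> hausdorff_measure t E = 0%E.
Proof.
move=> s0 st [D [C [D0 C0 cov]]]; have t0 : 0 < t by apply: lt_trans st.
have pre_ge0 d : (0 <= hausdorff_premeasure t d E)%E.
  apply/ereal_infP => _ [U _ <-].
  by apply: nneseries_ge0 => i _ _; exact: diam_pow_ge0.
have ts0 : 0 < t - s by rewrite subr_gt0.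
apply/eqP; rewrite eq_le; apply/andP; split; last first.
  apply: le_trans (pre_ge0 1) _; apply: ereal_sup_ubound.
  by exists 1 => //=; rewrite ltr01.
apply/ereal_supP => _ [delta /= delta0 <-]; apply/lee_addgt0Pr => e e0.
rewrite add0e.
(* with this radius the bound n * d ^ t <= C ^ s * d ^ (t - s) is below e *)
pose r := (e / C `^ s) `^ (t - s)^-1.
have r0 : 0 < r by rewrite powR_gt0 // divr_gt0 ?powR_gt0.
pose d := Num.min delta (Num.min D r).
have d0 : 0 < d by rewrite !lt_min delta0 D0.
have dD : d <= D by rewrite !ge_min lexx orbT.
have ddelta : d <= delta by rewrite ge_min lexx.
have dr : d <= r by rewrite !ge_min lexx !orbT.
have [|n En nle] := cov d; first by rewrite d0.
apply: (@le_trans _ _ (hausdorff_premeasure t d E)).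
  apply: le_ereal_inf => _ [U [Ud EU] <-]; exists U => //; split=> // i.
  by apply: le_trans (Ud i) _; rewrite lee_fin.
apply: le_trans (hausdorff_premeasure_coverable t0 (ltW d0) En) _.
rewrite lee_fin; apply: (@le_trans _ _ ((C / d) `^ s * d `^ t)).
  by rewrite ler_wpM2r ?powR_ge0.
rewrite (powR_div _ (ltW C0) (ltW d0)) mulrAC -mulrA -powRN -powRD; last first.
  by rewrite (gt_eqF d0) implybT.
rewrite mulrC -ler_pdivlMr ?powR_gt0 //.
have -> : e / C `^ s = r `^ (t - s).
  by rewrite -powRrM mulVf ?gt_eqF // powRr1 // ltW // divr_gt0 ?powR_gt0.
by rewrite ge0_ler_powR ?nnegrE // ltW.
Qed.

Lemma powRD_le (a b t : R) : 0 <= a -> 0 <= b -> 0 <= t ->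
  (a + b) `^ t <= 2 `^ t * (a `^ t + b `^ t).
Proof.
move=> a0 b0 t0.
have half x y : 0 <= y -> y <= x -> (x + y) `^ t <= 2 `^ t * x `^ t.
  move=> y0 yx; have x0 := le_trans y0 yx; rewrite -powRM //.
  by apply: ge0_ler_powR => //; rewrite ?nnegrE; lra.
have [ab|/ltW ba] := leP b a.
  apply: le_trans (half _ _ b0 ab) _.
  by rewrite ler_wpM2l ?powR_ge0 // lerDl powR_ge0.
rewrite addrC; apply: le_trans (half _ _ a0 ba) _.
by rewrite ler_wpM2l ?powR_ge0 // lerDr powR_ge0.
Qed.

Lemma compact_plane_cover E : compact E -> cover_compact E.
Proof.
(* the plane with a base point, since the characterization of compactness by
   covers is one for pointed spaces *)
pose T : ptopologicalType := HB.pack (R * R)%type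
  (Topological.class (R * R)%type) (Pointed.class (R * R)%type).
move=> cE; have -> : cover_compact E = @cover_compact T E by [].
by rewrite -compact_cover.
Qed.

(** Compactness reduces countable covers to finite ones: every set is enlarged
    to an open one, at a cost that sums up to little. *)
Lemma hausdorff_measure_neq0 E s t : compact E -> 0 <= t -> t < s ->
  thick_covers E s -> hausdorff_measure t E != 0%E.
Proof.
move=> cE t0 ts thick; apply/eqP => H0.
(* the exponent may be 0, where the powers of diameters are of no use; a larger
   one is still below s *)
pose u := (t + s) / 2.
have u0 : 0 < u by rewrite /u; lra.
have us : u < s by rewrite /u; lra.
have tu : t <= u by rewrite /u; lra.
have [eta eta0 fincov] := thick u u0 us.
pose e := eta / (2 `^ u * 4).
have e0 : 0 < e by rewrite divr_gt0 // mulr_gt0 // powR_gt0.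
have : (hausdorff_premeasure t 1 E < e%:E)%E.
  apply: (@le_lt_trans _ _ 0%E); last by rewrite lte_fin.
  by rewrite -H0; apply: ereal_sup_ubound; exists 1 => //=; rewrite ltr01.
move=> /ereal_inf_lt [_ [U [U1 EU] <-] Ue].
pose d i := fine (diam (U i)).
have dE i : (d i)%:E = diam (U i).
  rewrite /d fineK // ge0_fin_numE ?diam_ge0 //.
  by apply: le_lt_trans (U1 i) _; rewrite ltey.
have d0 i : 0 <= d i by rewrite -lee_fin dE diam_ge0.
have d1 i : d i <= 1 by rewrite -lee_fin dE; exact: U1.
have Ud i x y : U i x -> U i y -> eucl_dist x y <= d i.
  have /diam_leP[_ H] : (diam (U i) <= (d i)%:E)%E by rewrite dE.
  exact: H.
(* as (4 * w i) `^ u = e / 2 ^ i.+1, the enlargements cost e altogether *)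
pose w i := (e / (2 ^ i.+1)%:R) `^ u^-1 / 4.
have w0 i : 0 < w i by rewrite divr_gt0 // powR_gt0 // divr_gt0 // ltr0n expn_gt0.
pose V i := \bigcup_(x in U i) ball x (w i).
have [A _ EA] : finite_subset_cover [set: nat] V E.
  apply: (compact_plane_cover cE) => [i _|x /EU [i _ Ui]].
    by apply: bigcup_open => x _; exact: ball_open.
  by exists i => //; exists x => //; exact: ballxx.
pose n := (\max_(i <- finmap.enum_fset A) i).+1.
have := fincov n (fun i => V i) (fun i => d i + 4 * w i).
have Vd (i : 'I_n) : 0 <= d i + 4 * w i /\
    forall x y, V i x -> V i y -> eucl_dist x y <= d i + 4 * w i.
  split; first by rewrite addr_ge0 // mulr_ge0 // ltW.
  move=> x y [a Ua ax] [b Ub bx].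
  have near (p q : R * R) : ball p (w i) q -> eucl_dist p q <= 2 * w i.
    move=> [p1 p2]; apply: le_trans (eucl_dist_le_norm _ _) _.
    by rewrite mulr2n mulrDl !mul1r lerD // ltW.
  have xa := near _ _ ax; have yb := near _ _ bx; have ab := Ud i a b Ua Ub.
  have := eucl_dist_triangle x a y; have := eucl_dist_triangle a b y.
  rewrite (eucl_distC x a); lra.
have EV : E `<=` \bigcup_(i in [set: 'I_n]) V i.
  move=> x /EA [i iA Vi].
  have iltn : (i < n)%N by rewrite ltnS; apply: leq_bigmax_seq.
  by exists (Ordinal iltn).
move=> /(_ Vd EV); apply/negP; rewrite -ltNge.
have fourw i : (4 * w i) `^ u = e / (2 ^ i.+1)%:R.
  rewrite /w mulrC divfK // -powRrM mulVf ?gt_eqF // powRr1 //.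
  by rewrite ltW // divr_gt0 // ltr0n expn_gt0.
apply: (@le_lt_trans _ _ (2 `^ u * \sum_(i < n) (d i `^ u + e / (2 ^ i.+1)%:R))).
  rewrite mulr_sumr ler_sum // => i _; rewrite -fourw.
  by apply: powRD_le => //; [rewrite mulr_ge0 // ltW | exact: ltW].
suff : \sum_(i < n) (d i `^ u + e / (2 ^ i.+1)%:R) <= e + e.
  move=> sum2e; apply: (@le_lt_trans _ _ (2 `^ u * (e + e))).
    by rewrite ler_wpM2l // powR_ge0.
  have p0 : 0 < 2 `^ u :> R by rewrite powR_gt0.
  have -> : 2 `^ u * (e + e) = eta / 2 by rewrite /e; field; rewrite gt_eqF.
  lra.
rewrite -lee_fin EFinD.
apply: (@le_trans _ _ (\sum_(0 <= i <oo) (diam_pow t (U i)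
          + (e / (2 ^ i.+1)%:R)%:E))%E); last first.
  apply: le_trans (epsilon_trick _ _ (ltW e0)) _ => [i|].
    exact: diam_pow_ge0.
  by rewrite leeD2r // ltW.
have pos i : (0 <= diam_pow t (U i) + (e / (2 ^ i.+1)%:R)%:E)%E.
  by rewrite adde_ge0 ?diam_pow_ge0 // lee_fin divr_ge0 // ltW.
apply: le_trans (nneseries_lim_ge n (fun i _ _ => pos i)).
rewrite big_mkord -sumEFin; apply: lee_sum => i _; rewrite EFinD leeD2r //.
rewrite /diam_pow; case: pselect => [Ui0|?].
  have -> : d i = 0.
    by rewrite /d Ui0; apply/eqP; rewrite eq_le -Ui0 d0 -lee_fin dE Ui0 diam_set0_le.
  by rewrite powR0 ?gt_eqF.
rewrite -dE poweR_EFin lee_fin; have := d0 i; rewrite le_eqVlt => /orP[/eqP<-|di].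
  by rewrite powR0 ?gt_eqF // powR_ge0.
by apply: ger_powR => //; rewrite di d1.
Qed.

Lemma hausdorff_dim_eq E s : compact E -> 0 < s ->
  economical_covers E s -> thick_covers E s -> hausdorff_dim E = s%:E.
Proof.
move=> cE s0 econ thick; apply/eqP; rewrite eq_le; apply/andP; split.
  apply/lee_addgt0Pr => e e0; apply: ereal_inf_lbound.
  exists (s + e); last by rewrite EFinD.
  split; first by rewrite ltW // addr_gt0.
  by apply: (@hausdorff_measure_eq0 E s) => //; rewrite ltrDl.
apply/ereal_infP => _ [t [t0 Ht] <-]; rewrite lee_fin leNgt; apply/negP => ts.
by have /eqP := hausdorff_measure_neq0 cE t0 ts thick.
Qed.

Lemma has_box_dim_eq E s : 0 < s ->
  economical_covers E s -> thick_covers E s -> has_box_dim E s.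
Proof.
move=> s0 [D [C [D0 C0 cov]]] thick.
have cnum delta : exists n, 0 < delta -> covering_number E delta n.
  have [delta0|_] := ltP 0 delta; last by exists 0%N.
  have [|n0 En0 _] := cov (Num.min delta D).
    by rewrite lt_min delta0 D0 ge_min lexx orbT.
  have ex : exists n, `[< coverable E delta n >].
    exists n0; apply/asboolP; apply: coverable_le En0.
    by rewrite ge_min lexx.
  exists (ex_minn ex) => _; case: ex_minnP => m /asboolP Em minm.
  by split=> // k Ek; apply: minm; exact/asboolP.
have [N NP] := choice cnum; exists N; split=> //.
apply/cvgrPdist_le => e e0 /=.
pose t := Num.max (s / 2) (s - e / 2).
have t0 : 0 < t by rewrite lt_max divr_gt0.
have ts : t < s by rewrite gt_max; apply/andP; split; lra.
have te : s - e / 2 <= t by rewrite le_max lexx orbT.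
have [eta eta0 fincov] := thick t t0 ts.
(* with L := - ln delta both bounds on ln N are linear in L, and for L > M the
   constants ln eta and ln C are absorbed by e * L *)
pose M := 1 + (2 * `|ln eta| + s * `|ln C|) / e.
near=> delta.
have delta0 : 0 < delta by near: delta; exact: nbhs_right_gt.
have deltaD : delta <= D by rewrite ltW //; near: delta; exact: nbhs_right_lt.
have deltaM : delta < expR (- M).
  by near: delta; apply: nbhs_right_lt; exact: expR_gt0.
pose L := - ln delta.
have ML : M < L.
  by rewrite /L ltrNr -[- M]expRK ltr_ln ?posrE ?expR_gt0.
have M1 : 1 <= M.
  by rewrite lerDl divr_ge0 ?addr_ge0 ?mulr_ge0 // ltW.
have L0 : 0 < L by rewrite (lt_trans _ ML) // (lt_le_trans _ M1).
have eL : 2 * `|ln eta| + s * `|ln C| <= e * L.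
  rewrite [leRHS]mulrC -ler_pdivrMr //; apply: ltW; rewrite (le_lt_trans _ ML) //.
  by rewrite lerDr.
have [[U [Ud EU]] minN] := NP delta delta0.
have etaN : eta <= (N delta)%:R * delta `^ t.
  have := fincov _ U (fun=> delta); rewrite sumr_const card_ord mulr_natl; apply=> //.
  by move=> i; have /diam_leP := Ud i.
have N0 : 0 < (N delta)%:R :> R.
  rewrite lt_neqAle ler0n andbT; apply/eqP => N0.
  by move: etaN; rewrite -N0 mul0r leNgt eta0.
have low : ln eta <= ln (N delta)%:R - t * L.
  have : ln eta <= ln ((N delta)%:R * delta `^ t).
    by rewrite ler_ln // posrE // mulr_gt0 // powR_gt0.
  by rewrite lnM ?posrE ?powR_gt0 // ln_powR /L mulrN opprK.
have high : ln (N delta)%:R <= s * (ln C + L).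
  have [|n En nle] := cov delta; first by rewrite delta0.
  have : ln (N delta)%:R <= ln ((C / delta) `^ s).
    rewrite ler_ln ?posrE ?powR_gt0 ?divr_gt0 //.
    by apply: le_trans nle; rewrite ler_nat; exact: minN.
  by rewrite ln_powR lnM ?posrE ?invr_gt0 // lnV ?posrE.
have -> : - (ln (N delta)%:R / ln delta) = ln (N delta)%:R / L.
  by rewrite /L invrN mulrN.
have le1 := ler_norm (ln C); have le2 := ler_norm (- ln eta).
rewrite normrN in le2; have n1 := normr_ge0 (ln eta).
have n2 : 0 <= s * `|ln C| by rewrite mulr_ge0 // ltW.
have sC : s * ln C <= s * `|ln C| by rewrite ler_wpM2l // ltW.
have tL : (s - e / 2) * L <= t * L by rewrite ler_wpM2r // ltW.
rewrite distrC ler_distl ler_pdivlMr // ler_pdivrMr //; apply/andP; split; nra.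
Unshelve. all: by end_near.
Qed.

(** Moran's theorem for plane sets under the strong open set condition: one piece
    of [E] keeps a positive distance from the complement of [O]. *)
Theorem self_similar_dimension E (O : set (R * R)) (K : finType)
    (S : K -> R * R -> R * R) (c : K -> R) (k0 : K) (r0 D s : R) :
  packing E O S c -> (forall k, c k < 1) ->
  E `<=` \bigcup_k (S k @` E) -> compact E -> E !=set0 ->
  0 < D -> (forall x y, E x -> E y -> eucl_dist x y <= D) ->
  0 < r0 -> (forall x y, E x -> eucl_dist (S k0 x) y < r0 -> O y) ->
  0 < s -> \sum_k c k `^ s = 1 ->
  hausdorff_dim E = s%:E /\ has_box_dim E s.
Proof.
move=> pack c1 ES cE E0 D0 ED r00 inO s0 sum1.
have [Sc SE _ _] := pack.
have c0 k : 0 < c k by have [/andP[]] := Sc k.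
have econ : economical_covers E s.
  have [||||C C0 CP] := @coverable_powR _ K S c E D s _ _ ES D0 ED.
  - by move=> k; rewrite c0 c1.
  - by move=> k; have [] := Sc k.
  - exact: ltW s0.
  - by rewrite sum1.
  - by exists D, C.
have thick : thick_covers E s.
  move=> t t0 ts; apply: (finite_cover_ge pack c1 E0 r00 inO t0).
  rewrite -sum1; apply: ltr_sum => [|k _].
    by apply/hasP; exists k0; rewrite ?mem_index_enum.
  have -> : c k `^ s = c k `^ (s - t) * c k `^ t.
    by rewrite -powRD ?subrK // (gt_eqF (c0 k)) implybT.
  by rewrite gtr_pMl ?powR_gt0 // powR_lt1 ?subr_gt0 // ltW.
by split; [exact: hausdorff_dim_eq | exact: has_box_dim_eq].
Qed.

End FractalDimensions.

(** * Subdivisions of the unit interval *)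

Section Subdivisions.
Context {R : realType}.
Implicit Types (p : nat -> R) (u v x : R).

Definition subdivision m p : Prop :=
  [/\ p 0%N = 0, p m = 1 & forall k, (k < m)%N -> p k < p k.+1].

(** On the cell between [p i] and [p i.+1] this is the affine bijection onto
    the unit interval; it is 0 to the left of the cell and 1 to the right. *)
Definition coord p i u : R :=
  (Num.min u (p i.+1) - Num.min u (p i)) / (p i.+1 - p i).

Definition emb p i x : R := p i + (p i.+1 - p i) * x.

Lemma unit_itvE x : unit_itv x = (0 <= x <= 1) :> Prop.
Proof. by rewrite /unit_itv /= in_itv. Qed.

Context {m : nat} {p : nat -> R} (subp : subdivision m p).

Lemma subdivision_width i : (i < m)%N -> 0 < p i.+1 - p i.
Proof. by case: subp => _ _ H im; rewrite subr_gt0 H. Qed.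

Lemma subdivision_le i j : (i <= j)%N -> (j <= m)%N -> p i <= p j.
Proof.
elim: j => [|j IH]; first by rewrite leqn0 => /eqP->.
rewrite leq_eqVlt => /orP[/eqP->//|ij] jm.
have [_ _ /(_ j jm)/ltW] := subp; apply: le_trans.
by apply: IH => //; exact: ltnW.
Qed.

Lemma subdivision_itv i : (i <= m)%N -> unit_itv (p i).
Proof.
move=> im; have [p0 pm _] := subp; rewrite unit_itvE -{1}p0 -pm.
by rewrite !subdivision_le.
Qed.

Lemma cell_exists u : (0 < m)%N -> unit_itv u -> exists i : 'I_m, p i <= u <= p i.+1.
Proof.
move=> m0; rewrite unit_itvE => /andP[u0 u1].
have [p0 pm _] := subp.
have : forall k, (k <= m)%N -> u <= p k ->
    (k = 0)%N \/ exists i : 'I_m, p i <= u <= p i.+1.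
  elim=> [|k IH km uk]; [by left | right].
  have [ku|/ltW ku] := leP (p k) u; first by exists (Ordinal km); rewrite ku.
  have [k0|//] := IH (ltnW km) ku.
  by exists (Ordinal km) => /=; rewrite uk andbT k0 p0.
move=> /(_ m (leqnn m)); rewrite pm => /(_ u1) [m00|//].
by rewrite m00 in m0.
Qed.

Lemma coord_left i u : (i < m)%N -> u <= p i -> coord p i u = 0.
Proof.
move=> im ui; rewrite /coord (min_idPl ui) (min_idPl _) ?subrr ?mul0r //.
by apply: le_trans ui _; rewrite -subr_ge0 ltW // subdivision_width.
Qed.

Lemma coord_right i u : (i < m)%N -> p i.+1 <= u -> coord p i u = 1.
Proof.
move=> im ui; have w := subdivision_width im.
rewrite /coord (min_idPr ui) (min_idPr _) ?divff ?gt_eqF //.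
by apply: le_trans ui; rewrite -subr_ge0 ltW.
Qed.

Lemma coord_in i u : p i <= u <= p i.+1 ->
  coord p i u = (u - p i) / (p i.+1 - p i).
Proof. by move=> /andP[iu ui]; rewrite /coord (min_idPl ui) (min_idPr iu). Qed.

Lemma coord_itv i u : (i < m)%N -> unit_itv (coord p i u).
Proof.
move=> im; have w := subdivision_width im; rewrite unit_itvE /coord.
rewrite ler_pdivrMr // mul1r divr_ge0 ?(ltW w) //= !minEle.
all: by do 2 case: ifPn; rewrite -?ltNge; lra.
Qed.

Lemma coord_le i u v : (i < m)%N -> u <= v -> coord p i u <= coord p i v.
Proof.
move=> im uv; have w := subdivision_width im.
rewrite /coord ler_wpM2r ?invr_ge0 ?(ltW w) // !minEle.
by do 4 case: ifPn; rewrite -?ltNge; lra.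
Qed.

Lemma emb_itv i x : (i < m)%N -> unit_itv x -> p i <= emb p i x <= p i.+1.
Proof.
move=> im; rewrite unit_itvE => /andP[x0 x1]; have w := subdivision_width im.
rewrite /emb lerDl mulr_ge0 //=; last exact: ltW.
by rewrite -lerBrDl ler_piMr // ltW.
Qed.

Lemma emb_unit_itv i x : (i < m)%N -> unit_itv x -> unit_itv (emb p i x).
Proof.
move=> im x01; have /andP[ix xi] := emb_itv im x01.
have := subdivision_itv (ltnW im); have := subdivision_itv im.
rewrite !unit_itvE => /andP[_ pi1] /andP[pi0 _].
by rewrite (le_trans pi0) // (le_trans xi).
Qed.

Lemma embK i x : (i < m)%N -> unit_itv x -> coord p i (emb p i x) = x.
Proof.
move=> im x01; rewrite coord_in; last exact: emb_itv.
by rewrite /emb addrC addKr mulrC mulKf // gt_eqF // subdivision_width.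
Qed.

Lemma coordK i u : (i < m)%N -> p i <= u <= p i.+1 -> emb p i (coord p i u) = u.
Proof.
move=> im iu; rewrite coord_in // /emb mulrC divfK ?gt_eqF ?subdivision_width //.
by rewrite addrC subrK.
Qed.

Lemma coord_emb_neq i j x y : (i < m)%N -> (j < m)%N -> i != j ->
  unit_itv x -> unit_itv y -> coord p j (emb p i x) = coord p j (emb p i y).
Proof.
move=> im jm ij x01 y01.
have /andP[ix xi] := emb_itv im x01; have /andP[iy yi] := emb_itv im y01.
have [lt|gt|e] := ltngtP i j; last by rewrite e eqxx in ij.
  have le := subdivision_le lt (ltnW jm).
  by rewrite !coord_left // (le_trans _ le).
have le := subdivision_le gt (ltnW im).
by rewrite !coord_right // (le_trans le).
Qed.

Lemma sum_coord u : unit_itv u ->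
  \sum_(i < m) (p i.+1 - p i) * coord p i u = u.
Proof.
rewrite unit_itvE => /andP[u0 u1]; have [p0 pm _] := subp.
transitivity (\sum_(i < m) (Num.min u (p i.+1) - Num.min u (p i))).
  apply: eq_bigr => i _; rewrite /coord mulrC divfK //.
  by rewrite gt_eqF // subdivision_width.
rewrite -(big_mkord xpredT (fun i => Num.min u (p i.+1) - Num.min u (p i))).
by rewrite telescope_sumr // pm p0 (min_idPl u1) (min_idPr u0) subr0.
Qed.

(** The coordinates are 1 to the left of the cell of [u] and 0, where the
    summands vanish, to its right. *)
Lemma sum_cell (F : 'I_m -> R -> R) (i : 'I_m) u :
  (forall k, F k 0 = 0) -> p i <= u <= p i.+1 ->
  \sum_k F k (coord p k u) =
  \sum_(k < m | (k < i)%N) F k 1 + F i (coord p i u).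
Proof.
move=> F0 /andP[iu ui]; rewrite (bigID (fun k : 'I_m => (k < i)%N)) /=.
congr (_ + _).
  apply: eq_bigr => k ki; rewrite coord_right //.
  by apply: le_trans iu; apply: subdivision_le => //; exact: ltnW.
rewrite (bigD1 i) ?ltnn //= big1 ?addr0 // => k /andP[]; rewrite -leqNgt => ik ki.
rewrite coord_left ?F0 //; apply: le_trans ui _; apply: subdivision_le.
  by rewrite ltn_neqAle ik andbT eq_sym.
exact: ltnW.
Qed.

End Subdivisions.

(** * Quasi-copulas and their transformations *)

Section QuasiCopulaIncrements.
Context {R : realType}.
Implicit Types (Q : R -> R -> R).

Definition boundary Q : Prop := forall t, unit_itv t ->
  [/\ Q t 0 = 0, Q 0 t = 0, Q t 1 = t & Q 1 t = t].

(** Monotone and 1-Lipschitz in the first variable, in a form that is affine in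
    [Q] and closed under limits. *)
Definition tame_increments Q : Prop := forall u u' v,
  unit_itv u -> unit_itv u' -> unit_itv v -> u <= u' ->
  0 <= Q u' v - Q u v <= u' - u.

Lemma unit_itv0 : unit_itv (0 : R).
Proof. by rewrite unit_itvE lexx ler01. Qed.

Lemma unit_itv1 : unit_itv (1 : R).
Proof. by rewrite unit_itvE lexx ler01. Qed.

Lemma tame_lipschitz Q u u' v : tame_increments Q ->
  unit_itv u -> unit_itv u' -> unit_itv v -> `|Q u v - Q u' v| <= `|u - u'|.
Proof.
move=> inc u01 u'01 v01; have [uu'|/ltW uu'] := leP u u'.
  have /andP[i1 i2] := inc _ _ _ u01 u'01 v01 uu'.
  by rewrite !(distrC _ u') !(distrC _ (Q u' v)) !ger0_norm // subr_ge0.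
have /andP[i1 i2] := inc _ _ _ u'01 u01 v01 uu'.
by rewrite !ger0_norm // subr_ge0.
Qed.

Lemma quasi_copulaP Q : quasi_copula Q <->
  [/\ boundary Q, tame_increments Q & tame_increments (fun x y => Q y x)].
Proof.
split=> [[_ bQ mQ lQ]|[bQ inc1 inc2]].
  split=> // u u' v u01 u'01 v01 uu'; have [m1 m2] := mQ _ _ _ u01 u'01 v01 uu'.
    have := lQ _ _ _ _ u'01 v01 u01 v01.
    by rewrite subrr normr0 addr0 !ger0_norm ?subr_ge0 // m1.
  have := lQ _ _ _ _ v01 u'01 v01 u01.
  by rewrite subrr normr0 add0r !ger0_norm ?subr_ge0 // m2.
have lip1 := tame_lipschitz inc1; have lip2 := tame_lipschitz inc2.
split=> //.
- move=> u v u01 v01; have [_ b0 _ b1] := bQ v v01.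
  have [u0 u1] : 0 <= u /\ u <= 1 by apply/andP; rewrite -unit_itvE.
  have [v0 v1] : 0 <= v /\ v <= 1 by apply/andP; rewrite -unit_itvE.
  have := inc1 _ _ _ unit_itv0 u01 v01 u0.
  have := inc1 _ _ _ u01 unit_itv1 v01 u1.
  by rewrite b0 b1 unit_itvE; lra.
- move=> u1 u2 v u101 u201 v01 u12.
  have := inc1 _ _ _ u101 u201 v01 u12; have := inc2 _ _ _ u101 u201 v01 u12.
  by rewrite !subr_ge0 => /andP[-> _] /andP[-> _].
- move=> u1 v1 u2 v2 u101 v101 u201 v201.
  have := ler_normD (Q u1 v1 - Q u2 v1) (Q u2 v1 - Q u2 v2).
  rewrite addrA subrK => /le_trans; apply; apply: lerD; first exact: lip1.
  exact: (lip2 v1 v2 u2).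
Qed.

Lemma quasi_copula_prod : quasi_copula (fun u v : R => u * v).
Proof.
have inc : tame_increments (fun u v : R => u * v).
  move=> u u' v _ _; rewrite unit_itvE => /andP[v0 v1] uu'.
  by rewrite -mulrBl mulr_ge0 ?subr_ge0 //= ler_piMr // subr_ge0.
apply/quasi_copulaP; split=> //.
  by move=> t _; rewrite !mulr0 !mul0r mulr1 mul1r.
by move=> u u' v u01 u'01 v01 uu'; rewrite ![v * _]mulrC inc.
Qed.

End QuasiCopulaIncrements.

Section Transform.
Context {R : realType} {m : nat}.
Implicit Types (T : 'M[R]_m) (Q : R -> R -> R).

Lemma row_sumE T : row_sum T = col_sum T^T.
Proof.
apply/funext => k; apply: eq_bigr => j _.
by apply: eq_bigr => i _; rewrite mxE.
Qed.

Lemma quasi_transformation_tr T :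
  quasi_transformation T -> quasi_transformation T^T.
Proof.
move=> [s1 pc pr blk]; split.
- rewrite -s1 exchange_big; apply: eq_bigr => i _.
  by apply: eq_bigr => j _; rewrite mxE.
- by move=> i; under eq_bigr => j _ do rewrite mxE.
- by move=> i; under eq_bigr => j _ do rewrite mxE.
- move=> i1 i2 j1 j2 i12 j12 bd.
  rewrite exchange_big /=.
  under eq_bigr => j _ do under eq_bigr => i _ do rewrite mxE.
  by apply: blk => //; case/or4P: bd => ->; rewrite ?orbT.
Qed.

Lemma quasi_transformation_gt0 T : quasi_transformation T -> (0 < m)%N.
Proof.
case=> s1 _ _ _; case: (posnP m) => // m0; move: s1.
rewrite big1 => [/eqP|i _]; first by rewrite eq_sym oner_eq0.
by move: (ltn_ord i); rewrite {2}m0.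
Qed.

Lemma col_sumS T (i : 'I_m) : col_sum T i.+1 - col_sum T i = \sum_j T i j.
Proof.
rewrite /col_sum (bigD1 i) //= [X in _ + X - _](eq_bigl (fun k : 'I_m => (k < i)%N)).
  by rewrite addrK.
by move=> k; rewrite ltnS ltn_neqAle andbC.
Qed.

Lemma col_subdivision T : quasi_transformation T -> subdivision m (col_sum T).
Proof.
case=> s1 pc _ _; split.
- by rewrite /col_sum big_pred0.
- by rewrite /col_sum -s1; apply: eq_bigl => i; rewrite ltn_ord.
- by move=> k km; have := pc (Ordinal km); rewrite -col_sumS subr_gt0.
Qed.

Lemma row_subdivision T : quasi_transformation T -> subdivision m (row_sum T).
Proof. by move=> /quasi_transformation_tr/col_subdivision; rewrite row_sumE. Qed.

(** The formula defining [T(Q)] on each cell is the restriction of this single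
    expression, since the boundary values of [Q] turn the terms of the other
    cells into entries of [T] or their multiples by a coordinate. *)
Definition transform T Q (u v : R) : R :=
  \sum_i \sum_j T i j * Q (coord (col_sum T) i u) (coord (row_sum T) j v).

(** The part of the formula on a cell that does not depend on [Q]. *)
Definition transform_affine T (i j : 'I_m) (x y : R) : R :=
  \sum_(i' < m | (i' < i)%N) \sum_(j' < m | (j' < j)%N) T i' j'
  + x * (\sum_(j' < m | (j' < j)%N) T i j')
  + y * (\sum_(i' < m | (i' < i)%N) T i' j).

Lemma transform_cell T Q (i j : 'I_m) u v :
  quasi_transformation T -> boundary Q ->
  col_sum T i <= u <= col_sum T i.+1 -> row_sum T j <= v <= row_sum T j.+1 ->
  transform T Q u v =
  transform_affine T i j (coord (col_sum T) i u) (coord (row_sum T) j v)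
  + T i j * Q (coord (col_sum T) i u) (coord (row_sum T) j v).
Proof.
move=> qT bQ ui vj; have cs := col_subdivision qT; have rs := row_subdivision qT.
have c01 (k : 'I_m) w : unit_itv (coord (col_sum T) k w) by exact: (coord_itv cs).
have r01 (k : 'I_m) w : unit_itv (coord (row_sum T) k w) by exact: (coord_itv rs).
have Q0 y : unit_itv y -> Q 0 y = 0 by move=> /bQ[].
have Q1 y : unit_itv y -> Q 1 y = y by move=> /bQ[].
have Qx0 x : unit_itv x -> Q x 0 = 0 by move=> /bQ[].
have Qx1 x : unit_itv x -> Q x 1 = x by move=> /bQ[].
rewrite /transform (sum_cell cs (F := fun k x =>
  \sum_l T k l * Q x (coord (row_sum T) l v)) (i := i)) // => [|k]; last first.
  by rewrite big1 // => l _; rewrite Q0 ?mulr0.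
set x := coord _ i u; set y := coord _ j v.
rewrite (sum_cell rs (F := fun l y => T i l * Q x y) (i := j)) // => [|l]; last first.
  by rewrite Qx0 ?mulr0 //; exact: c01.
rewrite /transform_affine -/y Qx1 //; last exact: c01.
have -> : \sum_(k < m | (k < i)%N) \sum_l T k l * Q 1 (coord (row_sum T) l v) =
    \sum_(k < m | (k < i)%N) \sum_(l < m | (l < j)%N) T k l
    + y * \sum_(k < m | (k < i)%N) T k j.
  rewrite mulr_sumr -big_split /=; apply: eq_bigr => k _.
  rewrite (sum_cell rs (F := fun l y => T k l * Q 1 y) (i := j)) // => [|l]; last first.
    by rewrite Qx0 ?mulr0 //; exact: unit_itv1.
  rewrite -/y (Q1 y (r01 _ _)) mulrC; congr (_ + _); apply: eq_bigr => l _.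
  by rewrite Q1 ?mulr1 //; exact: unit_itv1.
by rewrite -mulr_suml; ring.
Qed.

Lemma transformP T Q Q' : quasi_transformation T -> boundary Q ->
  is_transform T Q Q' <->
  forall u v, unit_itv u -> unit_itv v -> Q' u v = transform T Q u v.
Proof.
move=> qT bQ; have cs := col_subdivision qT; have rs := row_subdivision qT.
have m0 := quasi_transformation_gt0 qT.
split=> [H u v u01 v01|H i j u v ui vj x y].
  have [i ui] := cell_exists cs m0 u01; have [j vj] := cell_exists rs m0 v01.
  by rewrite (transform_cell qT bQ ui vj) (H i j) // !coord_in.
rewrite H ?(transform_cell qT bQ ui vj) ?coord_in //.
  rewrite unit_itvE; case/andP: ui => iu ui.
  have := subdivision_itv cs (ltnW (ltn_ord i)).
  have := subdivision_itv cs (ltn_ord i).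
  by rewrite !unit_itvE => /andP[_ h1] /andP[h0 _]; rewrite (le_trans h0) ?(le_trans ui).
rewrite unit_itvE; case/andP: vj => jv vj.
have := subdivision_itv rs (ltnW (ltn_ord j)).
have := subdivision_itv rs (ltn_ord j).
by rewrite !unit_itvE => /andP[_ h1] /andP[h0 _]; rewrite (le_trans h0) ?(le_trans vj).
Qed.

Lemma transform_tr T Q u v :
  transform T^T (fun x y => Q y x) v u = transform T Q u v.
Proof.
rewrite /transform exchange_big /=; apply: eq_bigr => i _; apply: eq_bigr => j _.
by rewrite mxE !row_sumE trmxK.
Qed.

(** The initial sums of a column lie between 0 and its total, because blocks of
    entries touching the border have nonnegative sums. *)
Lemma col_head_itv T (i : 'I_m) k : quasi_transformation T -> (k <= m)%N ->
  0 <= \sum_(j < m | (j < k)%N) T i j <= \sum_j T i j.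
Proof.
move=> qT; have [_ _ _ blk] := qT; have m0 := quasi_transformation_gt0 qT.
have tot : \sum_(j < m | (j < m)%N) T i j = \sum_j T i j.
  by apply: eq_bigl => j; rewrite ltn_ord.
have pick1 (f : 'I_m -> R) : \sum_(i' < m | (i <= i' <= i)%N) f i' = f i.
  by rewrite (big_pred1 i) // => l; rewrite -eqn_leq eq_sym.
have head0 l : (l <= m)%N -> 0 <= \sum_(j < m | (j < l)%N) T i j.
  case: l => [|l] lm; first by rewrite big_pred0.
  have := blk i i (Ordinal m0) (Ordinal lm) (leqnn i) (leq0n _).
  by rewrite /= !orbT pick1; apply.
move=> km; rewrite head0 //=.
rewrite [leRHS](bigID (fun j : 'I_m => (j < k)%N)) /= lerDl.
move: km; rewrite leq_eqVlt => /orP[/eqP->|km].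
  by rewrite big_pred0 // => j; rewrite ltn_ord.
have mm : (m.-1 < m)%N by rewrite prednK.
have := blk i i (Ordinal km) (Ordinal mm) (leqnn i).
rewrite /= prednK // eqxx !orbT pick1 -ltnS prednK // => /(_ km isT).
congr (0 <= _); apply: eq_bigl => j.
by rewrite -leqNgt -(ltnS j) prednK // ltn_ord andbT.
Qed.

(** Only the entry of the cell containing [v] is weighted by a value of [D] other
    than 0 and [d], so that the sum lies between two initial sums of the column,
    both multiplied by [d]. *)
Lemma column_itv T (i : 'I_m) (D : R -> R) d v : quasi_transformation T ->
  unit_itv v -> D 0 = 0 -> D 1 = d ->
  (forall y, unit_itv y -> 0 <= D y <= d) ->
  0 <= \sum_j T i j * D (coord (row_sum T) j v) <= (\sum_j T i j) * d.
Proof.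
move=> qT v01 D0 D1 Dd; have rs := row_subdivision qT.
have [j vj] := cell_exists rs (quasi_transformation_gt0 qT) v01.
rewrite (sum_cell rs (F := fun j y => T i j * D y) (i := j)) // => [|k]; last first.
  by rewrite D0 mulr0.
rewrite D1 -mulr_suml.
have /andP[h0 h1] := col_head_itv i qT (ltnW (ltn_ord j)).
have := col_head_itv i qT (ltn_ord j).
rewrite (bigD1 j) //= (eq_bigl (fun k : 'I_m => (k < j)%N)); last first.
  by move=> k; rewrite ltnS ltn_neqAle andbC.
move=> /andP[h2 h3].
have /andP[d0 dd] := Dd _ (coord_itv rs v (ltn_ord j)).
move: h0 h1 h2 h3; set h := \sum_(k < m | _) _; set c := \sum_j T i j.
set y := D _ in d0 dd *; set a := T i j => h0 h1 h2 h3.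
by apply/andP; split; nra.
Qed.

(** The increment of [T(Q)] in the first variable is a sum over the columns of
    increments of [Q] in the coordinate of the column, and the widths of the
    columns times these coordinates add up to the variable. *)
Lemma transform_increments T Q : quasi_transformation T -> boundary Q ->
  tame_increments Q -> tame_increments (transform T Q).
Proof.
move=> qT bQ inc u u' v u01 u'01 v01 uu'; have cs := col_subdivision qT.
pose f (i : 'I_m) w := coord (col_sum T) i w.
have f01 i w : unit_itv (f i w) by exact: (coord_itv cs).
have colP i := @column_itv T i (fun y => Q (f i u') y - Q (f i u) y)
  (f i u' - f i u) v qT v01.
have -> : transform T Q u' v - transform T Q u v = \sum_i \sum_j
    T i j * (Q (f i u') (coord (row_sum T) j v) - Q (f i u) (coord (row_sum T) j v)).
  rewrite /transform -sumrB; apply: eq_bigr => i _; rewrite -sumrB.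
  by apply: eq_bigr => j _; rewrite mulrBr.
have {}colP i : 0 <= \sum_j T i j *
    (Q (f i u') (coord (row_sum T) j v) - Q (f i u) (coord (row_sum T) j v))
    <= (col_sum T i.+1 - col_sum T i) * (f i u' - f i u).
  rewrite col_sumS; apply: colP.
  - by have [-> _ _ _] := bQ _ (f01 i u'); have [-> _ _ _] := bQ _ (f01 i u); rewrite subrr.
  - by have [_ _ -> _] := bQ _ (f01 i u'); have [_ _ -> _] := bQ _ (f01 i u).
  - move=> y y01; apply: inc => //; exact: (coord_le cs).
apply/andP; split; first by apply: sumr_ge0 => i _; case/andP: (colP i).
rewrite -{2}(sum_coord cs u01) -{2}(sum_coord cs u'01) -sumrB.
by apply: ler_sum => i _; rewrite -mulrBr; case/andP: (colP i).
Qed.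

Lemma transform_boundary T Q : quasi_transformation T -> boundary Q ->
  boundary (transform T Q).
Proof.
move=> qT bQ.
have half T' Q' t : quasi_transformation T' -> boundary Q' -> unit_itv t ->
    transform T' Q' t 0 = 0 /\ transform T' Q' t 1 = t.
  move=> qT' bQ' t01; have cs := col_subdivision qT'.
  have rs := row_subdivision qT'.
  have f01 (i : 'I_m) w : unit_itv (coord (col_sum T') i w) by exact: (coord_itv cs).
  split.
    rewrite /transform big1 // => i _; rewrite big1 // => j _.
    rewrite (coord_left rs) //; last first.
      by have := subdivision_itv rs (ltnW (ltn_ord j)); rewrite unit_itvE => /andP[].
    by have [-> _ _ _] := bQ' _ (f01 i t); rewrite mulr0.
  rewrite -[RHS](sum_coord cs t01) /transform; apply: eq_bigr => i _.
  rewrite col_sumS mulr_suml; apply: eq_bigr => j _.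
  rewrite (coord_right rs) //; last first.
    by have := subdivision_itv rs (ltn_ord j); rewrite unit_itvE => /andP[].
  by have [_ _ -> _] := bQ' _ (f01 i t).
have bQ' : boundary (fun x y => Q y x) by move=> s /bQ[].
move=> t t01; have [-> ->] := half T Q t qT bQ t01.
by have [] := half _ _ t (quasi_transformation_tr qT) bQ' t01; rewrite !transform_tr.
Qed.

Lemma quasi_copula_transform T Q : quasi_transformation T ->
  quasi_copula Q -> quasi_copula (transform T Q).
Proof.
move=> qT /quasi_copulaP[bQ inc1 inc2]; apply/quasi_copulaP.
have bQ' : boundary (fun x y => Q y x) by move=> s /bQ[].
split; [exact: transform_boundary | exact: transform_increments |].
have := transform_increments (quasi_transformation_tr qT) bQ' inc2.
move=> H u u' v u01 u'01 v01 uu'.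
by rewrite -(transform_tr T Q v u') -(transform_tr T Q v u); exact: H.
Qed.

End Transform.

(** * The fixed quasi-copula *)

Section FixedPoint.
Context {R : realType} {m : nat}.
Implicit Types (T : 'M[R]_m) (Q : R -> R -> R).

Lemma unit_itv_dist (x y : R) : unit_itv x -> unit_itv y -> `|x - y| <= 1.
Proof.
rewrite !unit_itvE ler_norml => /andP[? ?] /andP[? ?].
by apply/andP; split; lra.
Qed.

(** At a given point [T(Q)] and [T(Q')] differ in the term of one cell only. *)
Lemma transform_contract T Q Q' k e : quasi_transformation T ->
  (forall i j, `|T i j| <= k) -> boundary Q -> boundary Q' ->
  (forall u v, unit_itv u -> unit_itv v -> `|Q u v - Q' u v| <= e) ->
  forall u v, unit_itv u -> unit_itv v ->
    `|transform T Q u v - transform T Q' u v| <= k * e.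
Proof.
move=> qT Tk bQ bQ' QQ' u v u01 v01.
have cs := col_subdivision qT; have rs := row_subdivision qT.
have m0 := quasi_transformation_gt0 qT.
have [i ui] := cell_exists cs m0 u01; have [j vj] := cell_exists rs m0 v01.
rewrite !(transform_cell (i := i) (j := j)) // opprD addrACA subrr add0r -mulrBr.
rewrite normrM; apply: ler_pM => //; apply: QQ'.
  exact: (coord_itv cs).
exact: (coord_itv rs).
Qed.

Lemma limit_itv (a b l : R) (x : nat -> R) :
  (forall n, a <= x n <= b) -> x n @[n --> \oo] --> l -> a <= l <= b.
Proof.
move=> axb xl; apply/andP; split.
  apply: (ler_cvg_to (cvg_cst a) xl); near=> n.
  by case/andP: (axb n).
apply: (ler_cvg_to xl (cvg_cst b)); near=> n.
by case/andP: (axb n).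
Unshelve. all: by end_near.
Qed.

(** The iterates that start with the product copula converge geometrically. *)
Lemma fixed_quasi_copula_exists T k : quasi_transformation T -> k < 1 ->
  (forall i j, `|T i j| <= k) -> exists Q, fixed_quasi_copula T Q.
Proof.
move=> qT k1 Tk; have m0 := quasi_transformation_gt0 qT.
have k0 : 0 <= k by apply: le_trans (Tk (Ordinal m0) (Ordinal m0)).
pose P n := iter n (transform T) (fun u v => u * v).
have Pq n : quasi_copula (P n).
  elim: n => [|n IH]; first exact: quasi_copula_prod.
  exact: quasi_copula_transform.
have Pb n : boundary (P n) by have /quasi_copulaP[] := Pq n.
have step n u v : unit_itv u -> unit_itv v -> `|P n.+1 u v - P n u v| <= k ^+ n.
  elim: n u v => [|n IH] u v u01 v01.
    have [H1 _ _ _] := Pq 1%N; have [H0 _ _ _] := Pq 0%N.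
    by rewrite expr0; apply: unit_itv_dist; [exact: H1 | exact: H0].
  by rewrite exprS; exact: (transform_contract qT Tk (Pb n.+1) (Pb n) IH).
have Pcvg u v : unit_itv u -> unit_itv v -> cvgn (fun n => P n u v).
  move=> u01 v01; set x := fun n => P n u v.
  have -> : x = (fun n => x 0%N + series (telescope x) n).
    by apply/funext => n; exact: eq_sum_telescope.
  apply: is_cvgD; first exact: is_cvg_cst.
  apply: normed_cvg; apply: (@series_le_cvg _ _ (geometric 1 k)) => //=.
  - by move=> n; rewrite mul1r exprn_ge0.
  - by move=> n; rewrite mul1r; exact: step.
  - by apply: is_cvg_geometric_series; rewrite ger0_norm.
pose Q u v := limn (fun n => P n u v).
have PQ u v : unit_itv u -> unit_itv v -> P n u v @[n --> \oo] --> Q u v.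
  by move=> u01 v01; exact: Pcvg.
have lim_eq u v c : unit_itv u -> unit_itv v -> (forall n, P n u v = c) -> Q u v = c.
  move=> u01 v01 Pc; apply/eqP; rewrite eq_le andbC.
  by apply: (@limit_itv _ _ _ (fun n => P n u v)) (PQ u v u01 v01) => n; rewrite Pc lexx.
have [i0 i1] := (unit_itv0 (R := R), unit_itv1 (R := R)).
have bQ : boundary Q.
  by move=> t t01; split; apply: lim_eq => // n; have [] := Pb n t t01.
have qQ : quasi_copula Q.
  apply/quasi_copulaP; split=> // u u' v u01 u'01 v01 uu'.
    apply: (@limit_itv _ _ _ (fun n => P n u' v - P n u v)) => [n|].
      by have /quasi_copulaP[_ inc _] := Pq n; exact: inc.
    by apply: cvgB; exact: PQ.
  apply: (@limit_itv _ _ _ (fun n => P n v u' - P n v u)) => [n|].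
    by have /quasi_copulaP[_ _ inc] := Pq n; exact: inc.
  by apply: cvgB; exact: PQ.
exists Q; split=> //; apply/transformP => // u v u01 v01.
have cs := col_subdivision qT; have rs := row_subdivision qT.
have [i ui] := cell_exists cs m0 u01; have [j vj] := cell_exists rs m0 v01.
have lim1 : P n.+1 u v @[n --> \oo] --> transform T Q u v.
  rewrite (transform_cell qT bQ ui vj).
  under eq_fun => n do rewrite /P iterS (transform_cell qT (Pb n) ui vj).
  apply: cvgD; first exact: cvg_cst.
  apply: cvgMl_tmp; apply: PQ; first exact: (coord_itv cs).
  exact: (coord_itv rs).
have lim2 : P n.+1 u v @[n --> \oo] --> Q u v.
  by have := PQ u v u01 v01; rewrite -cvg_shiftS.
exact: (norm_cvg_unique lim2 lim1).
Qed.

Lemma fixed_quasi_copula_unique T k Q Q' : quasi_transformation T -> k < 1 ->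
  (forall i j, `|T i j| <= k) ->
  fixed_quasi_copula T Q -> fixed_quasi_copula T Q' ->
  forall u v, unit_itv u -> unit_itv v -> Q' u v = Q u v.
Proof.
move=> qT k1 Tk [qQ fQ] [qQ' fQ'].
have m0 := quasi_transformation_gt0 qT.
have k0 : 0 <= k by apply: le_trans (Tk (Ordinal m0) (Ordinal m0)).
have /quasi_copulaP[bQ _ _] := qQ; have /quasi_copulaP[bQ' _ _] := qQ'.
have close n : forall u v, unit_itv u -> unit_itv v -> `|Q' u v - Q u v| <= k ^+ n.
  elim: n => [|n IH] u v u01 v01.
    have [H1 _ _ _] := qQ; have [H0 _ _ _] := qQ'.
    by rewrite expr0; apply: unit_itv_dist; [exact: H0 | exact: H1].
  rewrite ((transformP _ qT bQ).1 fQ u v) // ((transformP _ qT bQ').1 fQ' u v) //.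
  by rewrite exprS; exact: (transform_contract qT Tk bQ' bQ IH).
move=> u v u01 v01; apply/eqP; rewrite -subr_eq0 -normr_le0; apply/ler_addgt0Pr => e e0.
rewrite add0r; have [n kn] := pow_small k0 k1 e0.
by apply: le_trans kn; exact: close.
Qed.

Lemma QT_fixed T k : quasi_transformation T -> k < 1 ->
  (forall i j, `|T i j| <= k) -> fixed_quasi_copula T (QT T).
Proof.
move=> qT k1 Tk; rewrite /QT.
set P := [set Q | _]; suff [] : P (xget (fun _ _ => 0) P) by [].
have [Q fQ] := fixed_quasi_copula_exists qT k1 Tk.
apply: xgetPex; exists Q; split=> // Q' fQ'.
exact: (fixed_quasi_copula_unique qT k1 Tk fQ fQ').
Qed.

End FixedPoint.

Section SelfSimilarVolume.
Context {R : realType} {m : nat} {T : 'M[R]_m} {Q : R -> R -> R}.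
Hypotheses (qT : quasi_transformation T) (fQ : fixed_quasi_copula T Q).

Let cs := col_subdivision qT.
Let rs := row_subdivision qT.

Lemma fixed_boundary : boundary Q.
Proof. by have [/quasi_copulaP[]] := fQ. Qed.

Lemma volume_unit : volume Q 0 1 0 1 = 1.
Proof.
have [_ b1 _ b2] := fixed_boundary (unit_itv1 (R := R)).
have [_ b3 _ b4] := fixed_boundary (unit_itv0 (R := R)).
by rewrite /volume b1 b2 b3 b4; ring.
Qed.

Lemma volume_flat1 (a c d : R) : volume Q a a c d = 0.
Proof. by rewrite /volume; ring. Qed.

Lemma volume_flat2 (a b c : R) : volume Q a b c c = 0.
Proof. by rewrite /volume; ring. Qed.

Lemma volume_transform a b c d :
  unit_itv a -> unit_itv b -> unit_itv c -> unit_itv d ->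
  volume Q a b c d = \sum_i \sum_j T i j *
    volume Q (coord (col_sum T) i a) (coord (col_sum T) i b)
             (coord (row_sum T) j c) (coord (row_sum T) j d).
Proof.
move=> a01 b01 c01 d01.
have E u v : unit_itv u -> unit_itv v -> Q u v = transform T Q u v.
  by apply: (transformP _ qT fixed_boundary).1; have [] := fQ.
rewrite {1}/volume !E // /transform -!sumrB -big_split /=.
apply: eq_bigr => i _; rewrite -!sumrB -big_split /=.
by apply: eq_bigr => j _; rewrite /volume; ring.
Qed.

(** In the other cells one of the two coordinates is constant on the rectangle. *)
Lemma volume_cell (i j : 'I_m) a b c d :
  unit_itv a -> unit_itv b -> unit_itv c -> unit_itv d ->
  volume Q (emb (col_sum T) i a) (emb (col_sum T) i b)
           (emb (row_sum T) j c) (emb (row_sum T) j d) =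
  T i j * volume Q a b c d.
Proof.
move=> a01 b01 c01 d01; rewrite volume_transform.
2-3: exact: (emb_unit_itv cs).
2-3: exact: (emb_unit_itv rs).
rewrite (bigD1 i) //= (bigD1 j) //= !(embK cs) // !(embK rs) //.
rewrite [X in _ + X + _]big1 => [|l lj]; last first.
  by rewrite (coord_emb_neq rs (y := d)) // 1?eq_sym // volume_flat2 mulr0.
rewrite addr0 big1 ?addr0 // => k ki; rewrite big1 // => l _.
by rewrite (coord_emb_neq cs (y := b)) // 1?eq_sym // volume_flat1 mulr0.
Qed.

Lemma fixed_proper : (exists i j, T i j < 0) -> proper_quasi_copula Q.
Proof.
move=> [i [j Tij]]; split; first by have [] := fQ.
have [i0 i1] := (unit_itv0 (R := R), unit_itv1 (R := R)).
case=> _ pos; move: Tij; apply/negP; rewrite -leNgt.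
rewrite -[leRHS]mulr1 -volume_unit -volume_cell //.
have := emb_unit_itv cs (ltn_ord i) i0; have := emb_unit_itv cs (ltn_ord i) i1.
have := emb_unit_itv rs (ltn_ord j) i0; have := emb_unit_itv rs (ltn_ord j) i1.
rewrite !unit_itvE => /andP[_ h1] /andP[h2 _] /andP[_ h3] /andP[h4 _].
have w := subdivision_width cs (ltn_ord i); have h := subdivision_width rs (ltn_ord j).
by apply: pos => //; rewrite /emb mulr0 mulr1 lerD2l ltW.
Qed.

End SelfSimilarVolume.

(** * The support of the fixed quasi-copula *)

Section Support.
Context {R : realType}.
Implicit Types (Q : R -> R -> R) (x e : R).

Definition small_itv x e (a b : R) : Prop :=
  [/\ unit_itv a, unit_itv b, a <= b, x - e < a & b < x + e].

Lemma small_itv_le x e e' a b : e <= e' -> small_itv x e a b -> small_itv x e' a b.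
Proof. by move=> ee' [a01 b01 ab xa bx]; split=> //; lra. Qed.

(** Open null rectangles around a point may be shrunk to squares of half-width
    [e], which makes being in the support a statement about small rectangles. *)
Lemma suppP Q (z : R * R) : supp Q z <-> unit_square z /\
  forall e, 0 < e -> exists a b c d,
    [/\ small_itv z.1 e a b, small_itv z.2 e c d & volume Q a b c d != 0].
Proof.
have relopen x e : relopen_itv (`]x - e, x + e[ `&` unit_itv).
  split; last by exists `]x - e, x + e[%classic => //; exact: interval_open.
  move=> a b /= [ax a01] [bx b01] c /andP[ac cb]; split.
    by move: ax bx; rewrite /= !in_itv /= => /andP[h1 h2] /andP[h3 h4]; apply/andP; lra.
  by move: a01 b01; rewrite !unit_itvE => /andP[h1 h2] /andP[h3 h4]; apply/andP; lra.
split=> [[z01 nz]|[z01 big]].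
  split=> // e e0; apply: contrapT => none; apply: nz.
  exists (`]z.1 - e, z.1 + e[ `&` unit_itv), (`]z.2 - e, z.2 + e[ `&` unit_itv).
  split; last first.
    by case: z01 => z1 z2; split; split=> //=; rewrite in_itv /=; apply/andP; lra.
  split=> // a b c d ab cd sub; apply: contrapT => V; apply: none.
  have [[/=]] : ((`]z.1 - e, z.1 + e[ `&` unit_itv) `*`
      (`]z.2 - e, z.2 + e[ `&` unit_itv)) (a, c).
    by apply: sub; split; rewrite /= in_itv /= lexx.
  rewrite !in_itv /= => /andP[xa _] a01 [/andP[yc _] c01].
  have [[/=]] : ((`]z.1 - e, z.1 + e[ `&` unit_itv) `*`
      (`]z.2 - e, z.2 + e[ `&` unit_itv)) (b, d).
    by apply: sub; split; rewrite /= in_itv /= lexx andbT.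
  rewrite !in_itv /= => /andP[_ bx] b01 [/andP[_ dy] d01].
  by exists a, b, c, d; split=> //; apply/eqP.
split=> // -[I1 [I2 [[[_ [U1 oU1 I1E]] [_ [U2 oU2 I2E]] null]] [z1 z2]]].
have ball_in (U I : set R) x : open U -> I = U `&` unit_itv -> I x ->
    exists2 e, 0 < e & forall a b, small_itv x e a b -> `[a, b]%classic `<=` I.
  move=> oU IE; rewrite IE => -[Ux _].
  have /nbhs_ballP[e e0 eU] := open_nbhs_nbhs (conj oU Ux).
  exists e => // a b [a01 b01 ab xa bx] y /=; rewrite in_itv /= => /andP[ay yb].
  split; last first.
    by move: a01 b01; rewrite !unit_itvE => /andP[h1 _] /andP[_ h2]; rewrite (le_trans h1) // (le_trans yb).
  by apply: eU; rewrite -ball_normE /= ltr_distlC; apply/andP; split; lra.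
have [e1 e10 in1] := ball_in U1 I1 z.1 oU1 I1E z1.
have [e2 e20 in2] := ball_in U2 I2 z.2 oU2 I2E z2.
have [|a [b [c [d [ab cd]]]]] := big (Num.min e1 e2); first by rewrite lt_min e10.
move/eqP; apply; have [_ _ lab _ _] := ab; have [_ _ lcd _ _] := cd.
apply: null => // -[x y] [/= xab ycd]; split=> /=.
  by apply: in1 xab; apply: small_itv_le ab; rewrite ge_min lexx.
by apply: in2 ycd; apply: small_itv_le cd; rewrite ge_min lexx orbT.
Qed.

Lemma compact_unit_square : compact (@unit_square R).
Proof. by apply: compact_setX; exact: segment_compact. Qed.

Lemma compact_supp Q : compact (supp Q).
Proof.
have sub : supp Q `<=` unit_square by move=> z [].
apply: (subclosed_compact _ compact_unit_square sub) => z clz.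
have cu : closed (@unit_square R).
  by apply: compact_closed compact_unit_square; exact: norm_hausdorff.
apply/suppP; split; first by apply: cu; exact: (closure_subset sub clz).
move=> e e0; have e20 : 0 < e / 2 by rewrite divr_gt0.
have [y [/suppP[_ /(_ _ e20)[a [b [c [d [ab cd V]]]]]] [yz1 yz2]]] :=
  clz _ (nbhsx_ballx z _ e20).
move: yz1 yz2; rewrite -!ball_normE /= !ltr_distl => /andP[h1 h2] /andP[h3 h4].
exists a, b, c, d; case: ab cd => ? ? ? ? ? [? ? ? ? ?]; split=> //; split=> //; lra.
Qed.

End Support.

Section SelfSimilarSupport.
Context {R : realType} {m : nat} {T : 'M[R]_m} {Q : R -> R -> R}.
Hypotheses (qT : quasi_transformation T) (fQ : fixed_quasi_copula T Q).

Let p := col_sum T.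
Let q := row_sum T.
Let cs : subdivision m p := col_subdivision qT.
Let rs : subdivision m q := row_subdivision qT.

Lemma coord_lipschitz (s : nat -> R) (i : 'I_m) a u : subdivision m s ->
  `|coord s i a - coord s i u| <= `|a - u| / (s i.+1 - s i).
Proof.
move=> ss; have w := subdivision_width ss (ltn_ord i).
wlog ua : a u / u <= a.
  move=> H; have [/H//|/ltW/H] := leP u a.
  by rewrite distrC [`|u - a|]distrC.
have c := coord_le ss (ltn_ord i) ua.
rewrite !ger0_norm ?subr_ge0 // /coord -mulrBl ler_wpM2r ?invr_ge0 ?(ltW w) //.
by rewrite !minEle; do 4 case: ifPn; rewrite -?ltNge; lra.
Qed.

Lemma subdivision_width_le1 (s : nat -> R) (i : 'I_m) :
  subdivision m s -> s i.+1 - s i <= 1.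
Proof.
move=> ss; have := subdivision_itv ss (ltnW (ltn_ord i)).
by have := subdivision_itv ss (ltn_ord i); rewrite !unit_itvE => /andP[_ ?] /andP[? _]; lra.
Qed.

Lemma small_itv_emb (s : nat -> R) (i : 'I_m) x e a b : subdivision m s ->
  0 < e -> small_itv x e a b ->
  small_itv (emb s i x) e (emb s i a) (emb s i b).
Proof.
move=> ss e0 [a01 b01 ab xa bx]; have w := subdivision_width ss (ltn_ord i).
have w1 := subdivision_width_le1 i ss.
split; [exact: (emb_unit_itv ss)|exact: (emb_unit_itv ss)| | |]; rewrite /emb.
- by rewrite lerD2l ler_pM2l.
- by nra.
- by nra.
Qed.

Lemma small_itv_coord (s : nat -> R) (i : 'I_m) x e a b : subdivision m s ->
  small_itv x (e * (s i.+1 - s i)) a b ->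
  small_itv (coord s i x) e (coord s i a) (coord s i b).
Proof.
move=> ss [a01 b01 ab xa bx]; have w := subdivision_width ss (ltn_ord i).
have near y : x - e * (s i.+1 - s i) < y -> y < x + e * (s i.+1 - s i) ->
    `|coord s i y - coord s i x| < e.
  move=> xy yx; apply: le_lt_trans (coord_lipschitz _ _ _ ss) _.
  by rewrite ltr_pdivrMr // ltr_distl xy.
have := near a xa (le_lt_trans ab bx); have := near b (lt_le_trans xa ab) bx.
rewrite !ltr_distl => /andP[_ ?] /andP[? _].
by split=> //; [exact: (coord_itv ss)|exact: (coord_itv ss)|exact: (coord_le ss)].
Qed.

Lemma coord_locally_constant (s : nat -> R) (i : 'I_m) x : subdivision m s ->
  ~~ (s i <= x <= s i.+1) -> exists2 e, 0 < e & forall a b,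
    small_itv x e a b -> coord s i a = coord s i b.
Proof.
move=> ss; rewrite negb_and -!ltNge => /orP[xi|ix].
  exists (s i - x); first by rewrite subr_gt0.
  by move=> a b [_ _ ab _ bx]; rewrite !(coord_left ss) //; lra.
exists (x - s i.+1); first by rewrite subr_gt0.
by move=> a b [_ _ ab xa _]; rewrite !(coord_right ss) //; lra.
Qed.

Definition cell_map (k : 'I_m * 'I_m) (z : R * R) : R * R :=
  (emb p k.1 z.1, emb q k.2 z.2).

Lemma supp_cell_map k z : T k.1 k.2 != 0 -> supp Q z -> supp Q (cell_map k z).
Proof.
move=> Tk /suppP[[z1 z2] big]; apply/suppP; split.
  by split; [exact: (emb_unit_itv cs)|exact: (emb_unit_itv rs)].
move=> e e0; have [a [b [c [d [ab cd V]]]]] := big e e0.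
exists (emb p k.1 a), (emb p k.1 b), (emb q k.2 c), (emb q k.2 d).
split; [exact: small_itv_emb | exact: small_itv_emb |].
have [? ? _ _ _] := ab; have [? ? _ _ _] := cd.
by rewrite volume_cell // mulf_neq0.
Qed.

(** If no cell carries a preimage of [z] in the support, then near [z] every cell
    contributes 0 to the volume of a small rectangle: its entry is 0, or the cell
    is away from [z] and one of its coordinates is constant there, or the
    preimage of [z] has small null rectangles around it. *)
Lemma supp_self_similar : supp Q =
  \bigcup_(k in [set k | T k.1 k.2 != 0]) (cell_map k @` supp Q).
Proof.
apply/seteqP; split=> [z zQ|_ [k /= Tk [z zQ <-]]]; last exact: supp_cell_map.
apply: contrapT => none; have /suppP[[z1 z2] big] := zQ.
have null (k : 'I_m * 'I_m) : exists e, 0 < e /\ forall a b c d,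
    small_itv z.1 e a b -> small_itv z.2 e c d ->
    T k.1 k.2 * volume Q (coord p k.1 a) (coord p k.1 b)
                         (coord q k.2 c) (coord q k.2 d) = 0.
  have [->|Tk] := eqVneq (T k.1 k.2) 0.
    by exists 1; split=> // *; rewrite mul0r.
  have [z1k|/(coord_locally_constant cs)[e e0 H]] :=
      boolP (p k.1 <= z.1 <= p k.1.+1); last first.
    by exists e; split=> // a b c d /H-> _; rewrite volume_flat1 mulr0.
  have [z2k|/(coord_locally_constant rs)[e e0 H]] :=
      boolP (q k.2 <= z.2 <= q k.2.+1); last first.
    by exists e; split=> // a b c d _ /H->; rewrite volume_flat2 mulr0.
  pose y := (coord p k.1 z.1, coord q k.2 z.2).
  have yz : cell_map k y = z.
    by rewrite /cell_map /= (coordK cs) // (coordK rs) // -surjective_pairing.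
  have : ~ supp Q y by move=> yQ; apply: none; exists k => //; exists y.
  have y01 : unit_square y by split; [exact: (coord_itv cs)|exact: (coord_itv rs)].
  move=> /suppP/not_andP[//|/existsNP[e /not_implyP[e0 yN]]].
  have w := subdivision_width cs (ltn_ord k.1).
  have h := subdivision_width rs (ltn_ord k.2).
  exists (Num.min (e * (p k.1.+1 - p k.1)) (e * (q k.2.+1 - q k.2))).
  split; first by rewrite lt_min !mulr_gt0.
  move=> a b c d ab cd; apply/eqP; rewrite mulf_eq0 (negbTE Tk) /=.
  apply/negPn/negP => V; apply: yN.
  exists (coord p k.1 a), (coord p k.1 b), (coord q k.2 c), (coord q k.2 d).
  split=> //; apply: small_itv_coord => //.
    by apply: small_itv_le ab; rewrite ge_min lexx.
  by apply: small_itv_le cd; rewrite ge_min lexx orbT.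
have [e eP] := choice null.
have [lo /andP[lo0 _] loe] := finite_lower_bound (fun k => (eP k).1).
have [a [b [c [d [ab cd]]]]] := big lo lo0.
have [? ? _ _ _] := ab; have [? ? _ _ _] := cd.
rewrite (volume_transform qT fQ) // => /eqP; apply.
rewrite big1 // => i _; rewrite big1 // => j _.
by apply: (eP (i, j)).2; [move: ab | move: cd]; exact: small_itv_le.
Qed.

(** The cells at the corner shrink to the origin, and their volumes are the
    powers of a nonzero entry. *)
Lemma supp_origin (i : 'I_m) : i = 0%N :> nat -> T i i != 0 ->
  p 1%N < 1 -> q 1%N < 1 -> supp Q (0, 0).
Proof.
move=> i0 Tii p1 q1.
have w := subdivision_width cs (ltn_ord i); have h := subdivision_width rs (ltn_ord i).
have embp x : emb p i x = p 1%N * x.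
  by rewrite /emb i0; have [-> _ _] := cs; rewrite subr0 add0r.
have embq x : emb q i x = q 1%N * x.
  by rewrite /emb i0; have [-> _ _] := rs; rewrite subr0 add0r.
have p10 : 0 < p 1%N by move: w; rewrite i0; have [-> _ _] := cs; rewrite subr0.
have q10 : 0 < q 1%N by move: h; rewrite i0; have [-> _ _] := rs; rewrite subr0.
have u (x : R) n : 0 < x -> x < 1 -> unit_itv (x ^+ n).
  by move=> x0 x1; rewrite unit_itvE exprn_ge0 ?exprn_ile1 // ltW.
have V n : volume Q 0 (p 1%N ^+ n) 0 (q 1%N ^+ n) = T i i ^+ n.
  elim: n => [|n IH]; first by rewrite !expr0 (volume_unit fQ).
  have := volume_cell qT fQ i i unit_itv0 (u _ n p10 p1) unit_itv0 (u _ n q10 q1).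
  by rewrite -/p -/q !embp !embq !mulr0 IH -!exprS.
apply/suppP; split; first by split; exact: unit_itv0.
move=> e e0; have e20 : 0 < e / 2 by rewrite divr_gt0.
have [n pn] := pow_small (ltW p10) p1 e20.
have [n' qn] := pow_small (ltW q10) q1 e20.
pose N := (n + n')%N.
have pN : p 1%N ^+ N <= e / 2.
  apply: le_trans pn; rewrite exprD ler_piMr ?exprn_ge0 ?(ltW p10) //.
  by rewrite exprn_ile1 // ltW.
have qN : q 1%N ^+ N <= e / 2.
  apply: le_trans qn; rewrite exprD ler_piMl ?exprn_ge0 ?(ltW q10) //.
  by rewrite exprn_ile1 // ltW.
have pN0 : 0 < p 1%N ^+ N by rewrite exprn_gt0.
have qN0 : 0 < q 1%N ^+ N by rewrite exprn_gt0.
exists 0, (p 1%N ^+ N), 0, (q 1%N ^+ N); split.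
- by split; [exact: unit_itv0|exact: u|exact: ltW|rewrite /=; lra|rewrite /=; lra].
- by split; [exact: unit_itv0|exact: u|exact: ltW|rewrite /=; lra|rewrite /=; lra].
- by rewrite V expf_neq0.
Qed.

Hypothesis square_cells :
  forall i j : 'I_m, T i j != 0 -> p i.+1 - p i = q j.+1 - q j.

Lemma similitude_cell_map k : T k.1 k.2 != 0 ->
  similitude (p k.1.+1 - p k.1) (cell_map k).
Proof.
move=> Tk; have w := subdivision_width cs (ltn_ord k.1); have sq := square_cells Tk.
split=> [x y|y].
  by rewrite /cell_map /emb -sq (eucl_dist_scale (p k.1, q k.2)) // ltW.
exists ((y.1 - p k.1) / (p k.1.+1 - p k.1), (y.2 - q k.2) / (q k.2.+1 - q k.2)).
rewrite /cell_map /emb /= ![_ * (_ / _)]mulrC !divfK -?sq ?gt_eqF //.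
by rewrite ![_ + (_ - _)]addrC !subrK -surjective_pairing.
Qed.

Definition open_square : set (R * R) :=
  [set z | (0 < z.1 < 1) && (0 < z.2 < 1)].

Lemma emb_open (s : nat -> R) (i : 'I_m) x : subdivision m s ->
  0 < x < 1 -> s i < emb s i x < s i.+1.
Proof.
move=> ss /andP[x0 x1]; have w := subdivision_width ss (ltn_ord i).
by rewrite /emb; apply/andP; split; nra.
Qed.

Lemma emb_open_inj (s : nat -> R) (i j : 'I_m) x y : subdivision m s ->
  0 < x < 1 -> 0 < y < 1 -> emb s i x = emb s j y -> i = j.
Proof.
move=> ss x01 y01 e; apply/val_inj => /=.
have /andP[ix xi] := emb_open i ss x01; have /andP[jy yj] := emb_open j ss y01.
have [lt|gt|//] := ltngtP i j.
  have := subdivision_le ss lt (ltnW (ltn_ord j)).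
  by rewrite leNgt (lt_trans jy) // -e.
have := subdivision_le ss gt (ltnW (ltn_ord i)).
by rewrite leNgt (lt_trans ix) // e.
Qed.

Lemma emb_open_itv (s : nat -> R) (i : 'I_m) x : subdivision m s ->
  0 < x < 1 -> 0 < emb s i x < 1.
Proof.
move=> ss x01; have /andP[ix xi] := emb_open i ss x01.
have := subdivision_itv ss (ltnW (ltn_ord i)).
have := subdivision_itv ss (ltn_ord i); rewrite !unit_itvE => /andP[_ ?] /andP[? _].
by apply/andP; split; lra.
Qed.

Lemma packing_cell_map : packing (supp Q) open_square
  (fun k : {k : 'I_m * 'I_m | T k.1 k.2 != 0} => cell_map (val k))
  (fun k => p (val k).1.+1 - p (val k).1).
Proof.
split=> [[k Tk]|[k Tk] x|[k Tk] x|[k Tk] [l Tl] x y] /=.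
- split; last exact: similitude_cell_map.
  by rewrite (subdivision_width cs) // subdivision_width_le1.
- exact: supp_cell_map.
- by case/andP=> x1 x2; rewrite /open_square /= !emb_open_itv.
- case/andP=> x1 x2 /andP[y1 y2] [e1 e2]; apply/val_inj => /=.
  rewrite [k]surjective_pairing [l]surjective_pairing.
  by rewrite (emb_open_inj cs x1 y1 e1) (emb_open_inj rs x2 y2 e2).
Qed.

Lemma supp_cover : supp Q `<=` \bigcup_(k : {k : 'I_m * 'I_m | T k.1 k.2 != 0})
  (cell_map (val k) @` supp Q).
Proof.
move=> z; rewrite {1}supp_self_similar => -[k /= Tk [x xQ <-]].
by exists (Sub k Tk) => //; exists x.
Qed.

(** The cell [k0] away from the border provides the strong form of the open set
    condition, with the open unit square; the corner cell [i0] provides a point of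
    the support. *)
Theorem supp_dimension (i0 : 'I_m) (k0 : 'I_m * 'I_m) s :
  (forall k : 'I_m, p k.+1 - p k < 1) -> q 1%N < 1 ->
  i0 = 0%N :> nat -> T i0 i0 != 0 ->
  T k0.1 k0.2 != 0 -> 0 < p k0.1 -> p k0.1.+1 < 1 ->
  0 < q k0.2 -> q k0.2.+1 < 1 -> 0 < s ->
  \sum_(k | T k.1 k.2 != 0) (p k.1.+1 - p k.1) `^ s = 1 ->
  hausdorff_dim (supp Q) = s%:E /\ has_box_dim (supp Q) s.
Proof.
move=> w1 q1 i00 Ti0 Tk0 pk0 pk1 qk0 qk1 s0 sum1.
pose k0' : {k : 'I_m * 'I_m | T k.1 k.2 != 0} := Sub k0 Tk0.
pose r0 := Num.min (Num.min (p k0.1) (1 - p k0.1.+1))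
                   (Num.min (q k0.2) (1 - q k0.2.+1)).
apply: (self_similar_dimension (k0 := k0') (r0 := r0) (D := 2)
  packing_cell_map _ supp_cover) => //.
- exact: compact_supp.
- exists (0, 0); apply: (supp_origin i00) => //.
  by have := w1 i0; rewrite i00; have [-> _ _] := cs; rewrite subr0.
- move=> x y [[]]; rewrite !unit_itvE => /andP[? ?] /andP[? ?] _.
  move=> [[]]; rewrite !unit_itvE => /andP[? ?] /andP[? ?] _.
  apply: le_trans (eucl_dist_le_norm _ _) _.
  by rewrite mulr2n lerD // ler_distl; apply/andP; split; lra.
- by rewrite !lt_min !subr_gt0 pk0 pk1 qk0 qk1.
- move=> x y [[x1 x2] _] /=; rewrite !lt_min => /andP[/andP[a1 a2] /andP[a3 a4]].
  have := normr1_le_eucl_dist (cell_map k0 x) y.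
  have := normr2_le_eucl_dist (cell_map k0 x) y.
  rewrite !ler_distl => /andP[b1 b2] /andP[b3 b4].
  have /andP[e1 e2] := emb_itv cs (ltn_ord k0.1) x1.
  have /andP[e3 e4] := emb_itv rs (ltn_ord k0.2) x2.
  move: b1 b2 b3 b4; rewrite /cell_map /= => b1 b2 b3 b4.
  rewrite /open_square /=; apply/andP; split; apply/andP; split; lra.
- by rewrite -sum1 [RHS](big_sub (mem [pred k : 'I_m * 'I_m | T k.1 k.2 != 0])).
Qed.

Theorem supp_self_similar_set : (forall k : 'I_m, p k.+1 - p k < 1) ->
  (exists k : 'I_m * 'I_m, T k.1 k.2 != 0) -> self_similar (supp Q).
Proof.
move=> w1 [k Tk]; pose K := {k : 'I_m * 'I_m | T k.1 k.2 != 0}.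
exists #|{: K}|, (fun i => cell_map (val (enum_val i))); split.
- by apply/card_gt0P; exists (Sub k Tk).
- move=> i; case: (enum_val i) => l Tl /=; exists (p l.1.+1 - p l.1).
    by rewrite (subdivision_width cs) //= w1.
  by have [] := similitude_cell_map Tl.
- rewrite {1}supp_self_similar; apply/seteqP; split=> [_ [l /= Tl [x xQ <-]]|].
    exists (enum_rank (Sub l Tl : K)) => //; exists x => //.
    by rewrite enum_rankK.
  move=> _ [i _ [x xQ <-]]; case: (enum_val i) => l Tl /=.
  by exists l => //; exists x.
Qed.

End SelfSimilarSupport.

(** * Signed measures *)

Section SignedMeasuresOfFiniteMass.
Context {R : realType}.
Implicit Types (A B : set (R * R)) (mu : set (R * R) -> \bar R).

Lemma measurable_unit_square : measurable (@unit_square R).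
Proof. by apply: measurableX; exact: measurable_itv. Qed.

Lemma signed_measureU mu A B : signed_measure mu ->
  measurable A -> measurable B -> A `<=` unit_square -> B `<=` unit_square ->
  A `&` B = set0 -> mu (A `|` B) = (mu A + mu B)%E.
Proof.
move=> [mu0 _ sadd] mA mB AS BS AB.
have := sadd (bigcup2 A B); rewrite bigcup2E => lim.
have tri : trivIset setT (bigcup2 A B).
  move=> [|[|i]] [|[|j]] _ _ //= [x []] //= ; rewrite /bigcup2 /=.
  - by move=> Ax Bx; have : (A `&` B) x by []; rewrite AB.
  - by move=> Bx Ax; have : (A `&` B) x by []; rewrite AB.
have mAB n : measurable (bigcup2 A B n).
  by case: n => [|[|n]] //=; exact: measurable0.
have ABS n : bigcup2 A B n `<=` unit_square by case: n => [|[|n]].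
have {}lim := lim mAB ABS tri.
have cst : (\sum_(0 <= i < n) mu (bigcup2 A B i))%E @[n --> \oo] --> (mu A + mu B)%E.
  apply: cvg_near_cst; exists 2%N => // n /= n2.
  rewrite big_ltn ?(ltn_trans _ n2) // big_ltn // big_nat_cond big1 ?adde0 //.
  by move=> [|[|i]].
exact: (cvg_unique (@ereal_hausdorff R) lim cst).
Qed.

(** An infinite value could only be compensated by the opposite infinite value
    on the complement. *)
Lemma signed_measure_fin mu A : signed_measure mu ->
  mu unit_square \is a fin_num -> measurable A -> A `<=` unit_square ->
  mu A \is a fin_num.
Proof.
move=> smu fin mA AS.
have mC : measurable (unit_square `\` A).
  by apply: measurableD => //; exact: measurable_unit_square.
have CS : unit_square `\` A `<=` unit_square by move=> x [].
have := signed_measureU smu mA mC AS CS.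
rewrite setIDA [A `&` unit_square]setIidl // setDv setDUK // => /(_ erefl) E.
by move: fin; rewrite E; case: (mu A) => [r| |]; case: (mu _) => [s| |].
Qed.

Lemma signed_measure_charge mu : signed_measure mu ->
  mu unit_square \is a fin_num ->
  exists nu : {charge set (R * R)%type -> \bar R},
    forall A, measurable A -> A `<=` unit_square -> nu A = mu A.
Proof.
move=> smu fin; have [mu0 _ sadd] := smu.
pose nu A := mu (A `&` unit_square).
have nu0 : nu set0 = 0%E by rewrite /nu set0I.
have mS := measurable_unit_square.
have nuf A : measurable A -> nu A \is a fin_num.
  move=> mA; have mAS : measurable (A `&` unit_square) by exact: measurableI.
  by apply: (signed_measure_fin smu) => // x [].
have nus : semi_sigma_additive (nu : set (R * R)%type -> \bar R).
  move=> F mF tF mUF; rewrite /nu setI_bigcupl; apply: sadd.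
  - by move=> n; apply: measurableI.
  - by move=> n x [].
  - by apply: trivIset_setIr.
pose nuc : {charge set (R * R)%type -> \bar R} :=
  HB.pack (nu : set (R * R)%type -> \bar R) (isCharge.Build _ _ _ nu nu0 nuf nus).
by exists nuc => A mA AS; rewrite /nuc /= /nu setIidl.
Qed.

End SignedMeasuresOfFiniteMass.

Section Unassociated.
Context {R : realType} {m : nat} {T : 'M[R]_m} {Q : R -> R -> R}.
Hypotheses (qT : quasi_transformation T) (fQ : fixed_quasi_copula T Q).

Let p := col_sum T.
Let q := row_sum T.
Let cs : subdivision m p := col_subdivision qT.
Let rs : subdivision m q := row_subdivision qT.

(** Cells share edges, so that half-open rectangles are needed to make them
    disjoint. *)
Definition half_open (a b c d : R) : set (R * R) :=
  `]a, b]%classic `*` `]c, d]%classic.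

Lemma measurable_half_open a b c d : measurable (half_open a b c d).
Proof. by apply: measurableX; exact: measurable_itv. Qed.

Lemma setX_setUl (A B C : set R) : (A `|` B) `*` C = (A `*` C) `|` (B `*` C).
Proof.
apply/seteqP; split=> -[x y] /=; first by move=> [[?|?] ?]; [left|right].
by move=> [[? ?]|[? ?]]; split=> //; [left|right].
Qed.

Lemma setX_setUr (A B C : set R) : C `*` (A `|` B) = (C `*` A) `|` (C `*` B).
Proof.
apply/seteqP; split=> -[x y] /=; first by move=> [? [?|?]]; [left|right].
by move=> [[? ?]|[? ?]]; split=> //; [left|right].
Qed.

Lemma itv_split_left (a b : R) : a <= b ->
  `[a, b]%classic = `[a, a]%classic `|` `]a, b]%classic.
Proof.
move=> ab; apply/seteqP; split=> x /=; rewrite !in_itv /=.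
  by move=> /andP[ax xb]; have [ax'|xa] := ltP a x; [right|left; rewrite ax].
by move=> [/andP[ax xa]|/andP[/ltW-> ->]//]; rewrite ax (le_trans xa).
Qed.

Section Charge.
Variable nu : {charge set (R * R)%type -> \bar R}.
Hypothesis nuV : forall a b c d : R, 0 <= a -> a <= b -> b <= 1 ->
  0 <= c -> c <= d -> d <= 1 ->
  nu (`[a, b]%classic `*` `[c, d]%classic) = (volume Q a b c d)%:E.

Lemma charge_half_open a b c d : 0 <= a -> a <= b -> b <= 1 ->
  0 <= c -> c <= d -> d <= 1 ->
  nu (half_open a b c d) = (volume Q a b c d)%:E.
Proof.
move=> a0 ab b1 c0 cd d1.
have mI (i : interval R) : measurable [set` i] by exact: measurable_itv.
(* the left and lower edges are degenerate rectangles, of volume 0 *)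
have drop_left (C : set R) : measurable C -> nu (`[a, a]%classic `*` C) = 0%E ->
    nu (`[a, b]%classic `*` C) = nu (`]a, b]%classic `*` C).
  move=> mC nu0.
  have -> : `[a, b]%classic `*` C = (`[a, a]%classic `*` C) `|` (`]a, b]%classic `*` C).
    by rewrite -setX_setUl -itv_split_left.
  rewrite chargeU ?nu0 ?add0e //; [exact: measurableX|exact: measurableX|].
  apply/seteqP; split=> // -[x y] /= [[+ _] [+ _]]; rewrite !in_itv /=.
  by move=> /andP[_ xa] /andP[ax _]; move: ax; rewrite ltNge xa.
have drop_low (C : set R) : measurable C -> nu (C `*` `[c, c]%classic) = 0%E ->
    nu (C `*` `[c, d]%classic) = nu (C `*` `]c, d]%classic).
  move=> mC nu0.
  have -> : C `*` `[c, d]%classic = (C `*` `[c, c]%classic) `|` (C `*` `]c, d]%classic).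
    by rewrite -setX_setUr -itv_split_left.
  rewrite chargeU ?nu0 ?add0e //; [exact: measurableX|exact: measurableX|].
  apply/seteqP; split=> // -[x y] /= [[_ +] [_ +]]; rewrite !in_itv /=.
  by move=> /andP[_ xa] /andP[ax _]; move: ax; rewrite ltNge xa.
have left0 c' d' : 0 <= c' -> c' <= d' -> d' <= 1 ->
    nu (`[a, a]%classic `*` `[c', d']%classic) = 0%E.
  by move=> c'0 c'd' d'1; rewrite nuV ?volume_flat1 // (le_trans ab).
have c1 : c <= 1 by exact: le_trans d1.
have low0 : nu (`]a, b]%classic `*` `[c, c]%classic) = 0%E.
  by rewrite -(drop_left _ (mI _) (left0 _ _ c0 (lexx c) c1)) nuV // volume_flat2.
rewrite /half_open -(drop_low _ (mI _) low0).
by rewrite -(drop_left _ (mI _) (left0 _ _ c0 cd d1)) nuV.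
Qed.

Variables (P N : set (R * R)%type) (PN : hahn_decomposition nu P N).
Let var : {measure set (R * R)%type -> \bar R} := charge_variation PN.

Lemma measure_disjoint_le (K : finType) (F : K -> set (R * R)) H :
  measurable H -> (forall k, measurable (F k)) -> (forall k, F k `<=` H) ->
  (forall k l x, F k x -> F l x -> k = l) ->
  (\sum_k var (F k) <= var H)%E.
Proof.
move=> mH mF FH disj; rewrite fsbig_seq ?index_enum_uniq //.
rewrite -measure_fin_bigcup //; first last.
- by move=> k l _ _ [x [Fk Fl]]; exact: disj Fk Fl.
- apply: le_measure; rewrite ?inE //; last by move=> x [k _ /FH].
  by apply: fin_bigcup_measurable.
Qed.

(** A rectangle that carries a copy of [Q] scaled by [tau] has variation at
    least [`|tau|] times the sum of the absolute masses of the cells of order [n],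
    by induction on [n] through the cells of order 1. *)
Lemma charge_variation_ge n a alpha c beta tau :
  0 <= a -> 0 < alpha -> a + alpha <= 1 -> 0 <= c -> 0 < beta -> c + beta <= 1 ->
  (forall x x' y y', unit_itv x -> unit_itv x' -> unit_itv y -> unit_itv y' ->
    volume Q (a + alpha * x) (a + alpha * x') (c + beta * y) (c + beta * y') =
    tau * volume Q x x' y y') ->
  ((`|tau| * (\sum_i \sum_j `|T i j|) ^+ n)%:E <=
    var (half_open a (a + alpha) c (c + beta)))%E.
Proof.
have [i0 i1] := (unit_itv0 (R := R), unit_itv1 (R := R)).
elim: n a alpha c beta tau => [|n IH] a alpha c beta tau a0 al0 al1 c0 be0 be1 tauV.
  rewrite expr0 mulr1.
  have := tauV 0 1 0 1 i0 i1 i0 i1; rewrite !mulr0 !mulr1 !addr0.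
  rewrite (volume_unit fQ) mulr1 => <-.
  rewrite -abse_EFin -charge_half_open ?lerDl ?(ltW al0) ?(ltW be0) //.
  by apply: abse_charge_variation; exact: measurable_half_open.
pose F (k : 'I_m * 'I_m) := half_open (a + alpha * p k.1) (a + alpha * p k.1.+1)
                                      (c + beta * q k.2) (c + beta * q k.2.+1).
apply: (@le_trans _ _ (\sum_k var (F k))%E); last first.
  apply: measure_disjoint_le; first exact: measurable_half_open.
  - by move=> k; exact: measurable_half_open.
  - move=> k [x y] [] /=; rewrite !in_itv /= => /andP[x1 x2] /andP[y1 y2].
    have := subdivision_itv cs (ltnW (ltn_ord k.1)).
    have := subdivision_itv cs (ltn_ord k.1).
    have := subdivision_itv rs (ltnW (ltn_ord k.2)).
    have := subdivision_itv rs (ltn_ord k.2).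
    rewrite !unit_itvE => /andP[_ h1] /andP[h2 _] /andP[_ h3] /andP[h4 _].
    by split; rewrite /= in_itv /=; apply/andP; split; nra.
  - have lt_uniq (s : nat -> R) o e x (i j : 'I_m) : subdivision m s -> 0 < e ->
        o + e * s i < x <= o + e * s i.+1 -> o + e * s j < x <= o + e * s j.+1 ->
        i = j.
      move=> ss e0 /andP[ix xi] /andP[jx xj]; apply/val_inj => /=.
      have [lt|gt|//] := ltngtP i j.
        have := subdivision_le ss lt (ltnW (ltn_ord j)).
        have := lt_le_trans jx xi; rewrite ltrD2l ltr_pM2l // => h.
        by rewrite leNgt h.
      have := subdivision_le ss gt (ltnW (ltn_ord i)).
      have := lt_le_trans ix xj; rewrite ltrD2l ltr_pM2l // => h.
      by rewrite leNgt h.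
    move=> [i j] [k l] [x y] [] /=; rewrite !in_itv /= => x1 y1 [] /=.
    rewrite !in_itv /= => x2 y2.
    by rewrite (lt_uniq _ _ _ _ _ _ cs al0 x1 x2) (lt_uniq _ _ _ _ _ _ rs be0 y1 y2).
have -> : `|tau| * (\sum_i \sum_j `|T i j|) ^+ n.+1 = \sum_(k : 'I_m * 'I_m)
    `|tau * T k.1 k.2| * (\sum_i \sum_j `|T i j|) ^+ n.
  rewrite -mulr_suml exprS mulrA; congr (_ * _).
  by rewrite pair_bigA mulr_sumr; apply: eq_bigr => k _; rewrite normrM.
rewrite -sumEFin; apply: lee_sum => -[i j] _ /=; rewrite /F /=.
have w := subdivision_width cs (ltn_ord i); have h := subdivision_width rs (ltn_ord j).
have eqp : a + alpha * p i.+1 = a + alpha * p i + alpha * (p i.+1 - p i) by ring.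
have eqq : c + beta * q j.+1 = c + beta * q j + beta * (q j.+1 - q j) by ring.
have := subdivision_itv cs (ltnW (ltn_ord i)).
have := subdivision_itv cs (ltn_ord i).
have := subdivision_itv rs (ltnW (ltn_ord j)).
have := subdivision_itv rs (ltn_ord j).
rewrite !unit_itvE => /andP[_ h1] /andP[h2 _] /andP[_ h3] /andP[h4 _].
rewrite eqp eqq; apply: IH; rewrite -?eqp -?eqq.
- by rewrite addr_ge0 // mulr_ge0 // ltW.
- by rewrite mulr_gt0.
- by nra.
- by rewrite addr_ge0 // mulr_ge0 // ltW.
- by rewrite mulr_gt0.
- by nra.
move=> x x' y y' x01 x'01 y01 y'01.
have embE (s : nat -> R) o e k z :
    o + e * s k + e * (s k.+1 - s k) * z = o + e * emb s k z.
  by rewrite /emb; ring.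
rewrite !embE tauV ?volume_cell // ?mulrA //.
1-2: exact: (emb_unit_itv cs).
1-2: exact: (emb_unit_itv rs).
Qed.

End Charge.

Lemma sum_norm_gt1 : (exists i j, T i j < 0) -> 1 < \sum_i \sum_j `|T i j|.
Proof.
move=> [i [j Tij]]; have [<- _ _ _] := qT.
rewrite !pair_bigA /= (bigD1 (i, j)) //= [ltRHS](bigD1 (i, j)) //=.
apply: ltr_leD; last by apply: ler_sum => k _; exact: ler_norm.
by apply: lt_le_trans Tij _.
Qed.

(** The masses of the cells of order [n] are the products of [n] entries of [T],
    and their absolute values add up to a geometric sequence of ratio greater
    than 1, whereas a signed measure with finite total mass has finite
    variation. *)
Theorem proper_not_associated mu : (exists i j, T i j < 0) ->
  signed_measure mu -> ~ associated Q mu.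
Proof.
move=> neg smu assoc.
have unitE : mu unit_square = 1%E.
  have := assoc 0 1 0 1 (lexx _) ler01 (lexx _) (lexx _) ler01 (lexx _).
  by rewrite (volume_unit fQ).
have [|nu nuE] := signed_measure_charge smu; first by rewrite unitE.
have [P [N PN]] := Hahn_decomposition nu.
have nuV (a b c d : R) : 0 <= a -> a <= b -> b <= 1 -> 0 <= c -> c <= d -> d <= 1 ->
    nu (`[a, b]%classic `*` `[c, d]%classic) = (volume Q a b c d)%:E.
  move=> a0 ab b1 c0 cd d1; rewrite nuE ?assoc //.
    by apply: measurableX; exact: measurable_itv.
  move=> [x y] [] /=; rewrite !in_itv /= => /andP[ax xb] /andP[cy yd].
  by split; rewrite unit_itvE /=; apply/andP; split; lra.
have ge n := @charge_variation_ge nu nuV P N PN n 0 1 0 1 1 (lexx _) ltr01.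
pose V := charge_variation PN (half_open 0 1 0 1).
have Vfin : V \is a fin_num.
  by apply: fin_num_measure; exact: measurable_half_open.
have geV n : (\sum_i \sum_j `|T i j|) ^+ n <= fine V.
  rewrite -lee_fin fineK //; have := ge n; rewrite normr1 mul1r add0r; apply=> //.
  by move=> x x' y y' _ _ _ _; rewrite !mul1r !add0r.
have V0 : 0 < fine V + 1.
  by have := geV 0%N; rewrite expr0; lra.
have [n] := pow_large (sum_norm_gt1 neg) V0.
by apply/negP; rewrite -ltNge; apply: le_lt_trans (geV n) _; rewrite ltrDl.
Qed.

End Unassociated.

(** * The equation for the dimension *)

Section MoranEquation.
Context {R : realType}.
Implicit Types r s : R.

(** The value 1 singles out the similarity dimension [s] of the support. *)
Definition moran s r : R := (1 - r) `^ s + 9 * (r / 3) `^ s.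

Lemma moranE s r : 0 <= r -> moran s r = (1 - r) `^ s + 3 `^ (2 - s) * r `^ s.
Proof.
move=> r0; rewrite /moran powR_div // powRB; last by rewrite pnatr_eq0 implybT.
rewrite -[2]/(2%:R) powR_mulrn //; congr (_ + _).
by rewrite mulrA mulrAC; congr (_ * _ * _); ring.
Qed.

(** If [r1 = l * r2] with [l < 1], convexity of the power function on the
    segment from [1 - r2] to 1 forces [l <= l `^ s]. *)
Lemma moran_inj s r1 r2 : 1 < s -> 0 < r1 < 1 -> 0 < r2 < 1 ->
  moran s r1 = 1 -> moran s r2 = 1 -> r1 = r2.
Proof.
move=> s1; wlog lt12 : r1 r2 / r1 < r2.
  move=> H r101 r201 m1 m2; have [/H|/H|//] := ltgtP r1 r2; first exact.
  by move=> H'; apply/esym/H'.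
move=> /andP[r10 r11] /andP[r20 r21] m1 m2; exfalso.
have s0 : 0 < s by apply: lt_trans s1.
pose l := r1 / r2.
have l0 : 0 < l by rewrite divr_gt0.
have l1 : l < 1 by rewrite ltr_pdivrMr // mul1r.
have lr : l * r2 = r1 by rewrite divfK // gt_eqF.
have cvx : (1 - r1) `^ s <= l * (1 - r2) `^ s + (1 - l).
  have := @convex_powR R s (ltW s1) (Itv01 (ltW l0) (ltW l1)) (1 - r2) 1.
  rewrite !inE /= !in_itv /= !andbT subr_ge0 ler01 (ltW r21) => /(_ isT isT).
  rewrite convRE [X in X `^ _ <= _ -> _]convRE /= /unstable.onem powR1 !mulr1.
  by have -> : l * (1 - r2) + (1 - l) = 1 - r1 by rewrite -lr; ring.
move: m1 m2; rewrite !moranE ?(ltW r10) ?(ltW r20) //.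
rewrite -lr powRM ?(ltW l0) ?(ltW r20) // lr => m1 m2.
have ls : l `^ s < l.
  have -> : l `^ s = l `^ (s - 1) * l.
    rewrite -{3}(powRr1 (ltW l0)) -powRD ?subrK //.
    by rewrite (gt_eqF l0) implybT.
  by rewrite gtr_pMl // powR_lt1 ?subr_gt0 // ltW.
have K0 : 0 < 3 `^ (2 - s) * r2 `^ s by rewrite mulr_gt0 // powR_gt0.
move: cvx m1 m2 K0; rewrite mulrCA.
set A := _ `^ s; set B := _ `^ s; set C := _ * r2 `^ s => cvx m1 m2 C0.
have : l * C <= l `^ s * C by nra.
by rewrite ler_pM2r // leNgt ls.
Qed.

Lemma continuous_powR_base s r : 0 < r -> {for r, continuous (fun x => x `^ s)}.
Proof.
move=> r0; apply: differentiable_continuous; apply/derivable1_diffP.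
by apply: derivable_powR; rewrite in_itv /= andbT.
Qed.

Lemma moran_root_exists s : 1 < s < 2 -> exists r, 0 < r < 1 /\ moran s r = 1.
Proof.
move=> /andP[s1 s2]; have s0 : 0 < s by apply: lt_trans s1.
pose K : R := 3 `^ (2 - s).
have K1 : 1 < K.
  have -> : 1 = (3 : R) `^ 0 by rewrite powRr0.
  by rewrite /K /powR gt_eqF // ltr_expR ltr_pM2r ?subr_gt0 // ln_gt0 // ltr1n.
have K0 : 0 < K by apply: lt_trans K1.
have KV0 : 0 < K^-1 by rewrite invr_gt0.
have KV1 : K^-1 < 1 by rewrite invf_lt1.
have sB0 : 0 < s - 1 by rewrite subr_gt0.
(* K * r0 `^ s = r0, so that the value at r0 is at most 1 - r0 + r0, and
   K * r1 `^ s = 1 *)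
pose r0 := K^-1 `^ (s - 1)^-1; pose r1 := K^-1 `^ s^-1.
have r00 : 0 < r0 by rewrite powR_gt0.
have r11 : r1 < 1 by rewrite powR_lt1 ?invr_gt0 // ltW.
have r01 : r0 <= r1.
  by apply: ger_powR; rewrite ?KV0 ?(ltW KV1) // lef_pV2 ?posrE //; lra.
have r10 : 0 < r1 by apply: lt_le_trans r01.
have r0_lt1 : r0 < 1 by apply: le_lt_trans r11.
have m0 : moran s r0 <= 1.
  rewrite moranE ?(ltW r00) // -/K.
  have -> : r0 `^ s = r0 * K^-1.
    rewrite -(mulr_powRB1 (ltW r00) s0) /r0 -powRrM mulVf ?gt_eqF //.
    by rewrite powRr1 // ltW.
  rewrite mulrCA divff ?gt_eqF // mulr1.
  have : (1 - r0) `^ s <= 1 - r0.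
    by apply: ge1r_powR; [apply/andP; lra | exact: ltW].
  lra.
have m1 : 1 <= moran s r1.
  rewrite moranE ?(ltW r10) // -/K /r1 -powRrM mulVf ?gt_eqF //.
  by rewrite powRr1 ?(ltW KV0) // divff ?gt_eqF // lerDr powR_ge0.
have [||r] := @IVT _ (moran s) r0 r1 1 r01.
- apply: continuous_in_subspaceT => x; rewrite inE /= in_itv /= => /andP[x0 x1].
  apply: cvgD.
    apply: (@continuous_comp _ _ _ (fun y : R => 1 - y) (fun y => y `^ s)).
      by apply: cvgB; [exact: cvg_cst | exact: cvg_id].
    by apply: continuous_powR_base; rewrite subr_gt0 (le_lt_trans x1).
  apply: cvgMl_tmp.
  apply: (@continuous_comp _ _ _ (fun y : R => y / 3) (fun y => y `^ s)).
    by apply: cvgMr_tmp; exact: cvg_id.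
  by apply: continuous_powR_base; rewrite divr_gt0 // (lt_le_trans r00).
- by rewrite ge_min m0 le_max m1 orbT.
rewrite in_itv /= => /andP[rr0 rr1] mr; exists r; split=> //.
by rewrite (lt_le_trans r00) // (le_lt_trans rr1).
Qed.

(** The sum is [1 + 2 * r] at the exponent 1 and [1 - 2 * r * (1 - r)] at 2. *)
Lemma moran_exponent_exists r : 0 < r < 1 -> exists s, 1 < s < 2 /\ moran s r = 1.
Proof.
move=> /andP[r0 r1].
have d0 : 0 < 1 - r by rewrite subr_gt0.
have t0 : 0 < r / 3 by rewrite divr_gt0.
have m1 : 1 < moran 1 r.
  by rewrite /moran !powRr1 ?(ltW d0) ?(ltW t0) //; lra.
have m2 : moran 2 r < 1.
  rewrite /moran -[2]/(2%:R) !powR_mulrn ?(ltW d0) ?(ltW t0) //.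
  have -> : (1 - r) ^+ 2 + 9 * (r / 3) ^+ 2 = 1 - 2 * r * (1 - r) by field.
  have : 0 < r * (1 - r) by rewrite mulr_gt0.
  lra.
have pcont (a : R) : 0 < a -> continuous (fun s => a `^ s).
  move=> a0 s; rewrite /powR (gt_eqF a0).
  apply: (@continuous_comp _ _ _ (fun s => s * ln a) expR).
    by apply: cvgMr_tmp; exact: cvg_id.
  exact: continuous_expR.
have [|||s] := @IVT _ (fun s => moran s r) 1 2 1.
- by rewrite ler1n.
- apply: continuous_subspaceT => s; apply: cvgD; first exact: pcont.
  by apply: cvgMl_tmp; exact: pcont.
- by rewrite ge_min le_max (ltW m1) (ltW m2) orbT.
rewrite in_itv /= => /andP[]; rewrite le_eqVlt => /orP[/eqP<- _ e|s1].
  by move: m1; rewrite e ltxx.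
rewrite le_eqVlt => /orP[/eqP-> e|s2 e]; first by move: m2; rewrite e ltxx.
by exists s; rewrite s1 s2.
Qed.

End MoranEquation.

(** * The matrices of the theorem *)

Section MatrixTr.
Context {R : realType} {r : R}.
Hypothesis r01 : 0 < r < 1.

Let r0 : 0 < r. Proof. by case/andP: r01. Qed.
Let r1 : r < 1. Proof. by case/andP: r01. Qed.

Lemma TrE (i j : 'I_4) : Tr r i j =
  if (i == 0%N :> nat) || (j == 0%N :> nat) then
    (if (i == 0%N :> nat) && (j == 0%N :> nat) then 1 - r else 0)
  else if (i == 2%N :> nat) then (if j == 2%N :> nat then - (r / 15) else r / 5)
  else if j == 2%N :> nat then r / 5 else r / 15.
Proof.
rewrite mxE; case: i => [[|[|[|[|//]]]] Hi]; case: j => [[|[|[|[|//]]]] Hj] //=.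
Qed.

Lemma Tr_tr : (Tr r)^T = Tr r.
Proof.
apply/matrixP => i j; rewrite mxE !TrE orbC andbC.
by case: ifP => // _; case: eqP => // _; case: eqP.
Qed.

Lemma Tr_neq0 i j : (Tr r i j != 0) = ((i == 0%N :> nat) == (j == 0%N :> nat)).
Proof.
rewrite TrE; case: (i == 0%N :> nat); case: (j == 0%N :> nat) => /=; rewrite ?eqxx //.
  by rewrite subr_eq0 gt_eqF.
case: (i == 2%N :> nat); case: (j == 2%N :> nat);
  by rewrite ?oppr_eq0 mulf_neq0 ?gt_eqF ?invr_gt0.
Qed.

Lemma Tr_sum i : \sum_j Tr r i j = if i == 0%N :> nat then 1 - r else r / 3.
Proof.
rewrite !big_ord_recl big_ord0 !TrE /=.
by case: i => [[|[|[|[|//]]]] Hi] /=; field.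
Qed.

Lemma Tr_ge0 (i j : 'I_4) :
  ~~ ((i == 2%N :> nat) && (j == 2%N :> nat)) -> 0 <= Tr r i j.
Proof.
rewrite TrE; case: (i == 2%N :> nat); case: (j == 2%N :> nat) => //= _.
all: do 2?case: ifP => _; rewrite ?subr_ge0 ?divr_ge0 ?(ltW r1) ?(ltW r0) //.
Qed.

(** A block with a negative sum would have to contain the negative entry; if it
    also touches the border, it contains one of its four neighbours, which
    outweigh it. *)
Lemma Tr_block i1 i2 j1 j2 : (i1 <= i2)%N -> (j1 <= j2)%N ->
  [|| i1 == 0%N :> nat, i2.+1 == 4%N, j1 == 0%N :> nat | j2.+1 == 4%N] ->
  0 <= \sum_(i < 4 | (i1 <= i <= i2)%N) \sum_(j < 4 | (j1 <= j <= j2)%N) Tr r i j.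
Proof.
move=> i12 j12 border; rewrite pair_big_dep /=.
pose B (k : 'I_4 * 'I_4) := (i1 <= k.1 <= i2)%N && (j1 <= k.2 <= j2)%N.
pose c : 'I_4 * 'I_4 := (@Ordinal 4 2 isT, @Ordinal 4 2 isT).
have pos k : k != c -> 0 <= Tr r k.1 k.2.
  move=> kc; apply: Tr_ge0; apply: contraNN kc => /andP[k1 k2].
  by rewrite [k]surjective_pairing xpair_eqE -!val_eqE /= k1 k2.
have [Bc|nBc] := boolP (B c); last first.
  apply: sumr_ge0 => k Bk; apply: pos; apply: contraNneq nBc => <-; exact: Bk.
rewrite (bigD1 c) //=.
have [n [Bn nc Tn]] : exists n, [/\ B n, n != c & Tr r n.1 n.2 = r / 5].
  move: Bc; rewrite /B /= => /andP[/andP[a1 a2] /andP[b1 b2]].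
  case/or4P: border => /eqP e.
  - exists (@Ordinal 4 1 isT, @Ordinal 4 2 isT).
    by rewrite /= e b1 b2 TrE /= (leq_trans _ a2).
  - exists (@Ordinal 4 3 isT, @Ordinal 4 2 isT).
    by move: e => [e]; rewrite /= e b1 b2 TrE /= (leq_trans a1).
  - exists (@Ordinal 4 2 isT, @Ordinal 4 1 isT).
    by rewrite /= e a1 a2 TrE /= (leq_trans _ b2).
  - exists (@Ordinal 4 2 isT, @Ordinal 4 3 isT).
    by move: e => [e]; rewrite /= e a1 a2 TrE /= (leq_trans b1).
rewrite (bigD1 n) /=; last by rewrite nc andbT.
rewrite addrA addr_ge0 //; first by rewrite Tn /c TrE /=; have := r0; lra.
by apply: sumr_ge0 => k /andP[/andP[_ kc] _]; exact: pos.
Qed.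

Lemma quasi_transformation_Tr : quasi_transformation (Tr r).
Proof.
have row i : 0 < \sum_j Tr r i j.
  by rewrite Tr_sum; have := r0; have := r1; case: ifP => _; lra.
split=> //.
- under eq_bigr => i _ do rewrite Tr_sum.
  by rewrite !big_ord_recl big_ord0 /=; field.
- move=> j; have := row j; congr (0 < _); apply: eq_bigr => i _.
  by rewrite -[in LHS]Tr_tr mxE.
- exact: Tr_block.
Qed.

Lemma Tr_negative : exists i j, Tr r i j < 0.
Proof.
exists (@Ordinal 4 2 isT), (@Ordinal 4 2 isT); rewrite TrE /= oppr_lt0.
by rewrite divr_gt0.
Qed.

Lemma Tr_norm_le i j : `|Tr r i j| <= Num.max (1 - r) r.
Proof.
rewrite le_max TrE; case: ifP => _.
  by case: ifP => _; rewrite ?normr0 ?(ltW r0) ?orbT // ger0_norm ?lexx // subr_ge0 ltW.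
case: ifP => _; case: ifP => _; rewrite ?normrN ger0_norm ?divr_ge0 ?(ltW r0) //.
all: by apply/orP; right; have := r0; lra.
Qed.

Lemma QT_Tr_fixed : fixed_quasi_copula (Tr r) (QT (Tr r)).
Proof.
apply: (QT_fixed quasi_transformation_Tr _ Tr_norm_le).
by rewrite gt_max; have := r0; have := r1; move=> ? ?; apply/andP; lra.
Qed.

Lemma row_sum_Tr : row_sum (Tr r) = col_sum (Tr r).
Proof. by rewrite row_sumE Tr_tr. Qed.

Lemma col_width_Tr (i : 'I_4) : col_sum (Tr r) i.+1 - col_sum (Tr r) i =
  if i == 0%N :> nat then 1 - r else r / 3.
Proof. by rewrite col_sumS Tr_sum. Qed.

Lemma col_width_Tr_lt1 (i : 'I_4) :
  col_sum (Tr r) i.+1 - col_sum (Tr r) i < 1.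
Proof. by rewrite col_width_Tr; have := r0; have := r1; case: ifP => _; lra. Qed.

Lemma square_cells_Tr (i j : 'I_4) : Tr r i j != 0 ->
  col_sum (Tr r) i.+1 - col_sum (Tr r) i = row_sum (Tr r) j.+1 - row_sum (Tr r) j.
Proof. by rewrite row_sum_Tr !col_width_Tr Tr_neq0 => /eqP->. Qed.

Lemma sum_ratios_Tr s :
  \sum_(k | Tr r k.1 k.2 != 0) (col_sum (Tr r) k.1.+1 - col_sum (Tr r) k.1) `^ s
  = moran s r.
Proof.
under eq_bigl => k do rewrite Tr_neq0.
under eq_bigr => k _ do rewrite col_width_Tr.
rewrite big_mkcond -(pair_bigA _ (fun i j : 'I_4 =>
  if (i == 0%N :> nat) == (j == 0%N :> nat)
  then (if i == 0%N :> nat then 1 - r else r / 3) `^ s else 0)) /=.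
by rewrite !big_ord_recl !big_ord0 /= /moran; ring.
Qed.

Lemma supp_Tr_dimension s : 0 < s -> moran s r = 1 ->
  hausdorff_dim (supp (QT (Tr r))) = s%:E /\ has_box_dim (supp (QT (Tr r))) s.
Proof.
move=> s0 ms; have qT := quasi_transformation_Tr.
have [p0 p4 plt] := col_subdivision qT.
have p1 : col_sum (Tr r) 1%N = 1 - r.
  by have := col_width_Tr ord0; rewrite /= p0 subr0.
have p2 : 0 < col_sum (Tr r) 2%N.
  by apply: lt_trans (plt 1%N isT); rewrite p1 subr_gt0.
have p3 : col_sum (Tr r) 3%N < 1 by rewrite -p4; exact: plt.
apply: (supp_dimension qT QT_Tr_fixed square_cells_Tr
  (i0 := ord0) (k0 := (@Ordinal 4 2 isT, @Ordinal 4 2 isT))) => //.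
- exact: col_width_Tr_lt1.
- by rewrite row_sum_Tr p1; have := r0; lra.
- by rewrite Tr_neq0.
- by rewrite Tr_neq0.
- by rewrite row_sum_Tr.
- by rewrite row_sum_Tr.
- by rewrite sum_ratios_Tr.
Qed.

End MatrixTr.

Theorem theorem6 (R : realType) :
  (forall r : R, 0 < r < 1 ->
     [/\ proper_quasi_transformation (Tr r),
         proper_quasi_copula (QT (Tr r)),
         ~ (exists mu : set (R * R) -> \bar R,
              [/\ signed_measure mu, doubly_stochastic mu
                & associated (QT (Tr r)) mu])
       & self_similar (supp (QT (Tr r)))]) /\
  (forall s : R, 1 < s < 2 ->
     exists! r : R,
       [/\ 0 < r < 1,
           hausdorff_dim (supp (QT (Tr r))) = s%:E
         & has_box_dim (supp (QT (Tr r))) s]).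
Proof.
split=> [r r01|s s12].
  have qT := quasi_transformation_Tr r01; have fQ := QT_Tr_fixed r01.
  have neg := Tr_negative r01; split=> //.
  - exact: (fixed_proper qT fQ neg).
  - by move=> [mu [smu _ assoc]]; exact: (proper_not_associated qT fQ neg smu assoc).
  - apply: (supp_self_similar_set qT fQ).
    + by move=> i j; exact: (square_cells_Tr r01).
    + exact: (col_width_Tr_lt1 r01).
    + by exists (ord0, ord0); rewrite (Tr_neq0 r01).
have [s1 s2] := andP s12; have s0 : 0 < s by apply: lt_trans s1.
have [r [r01 mr]] := moran_root_exists s12; exists r.
split; first by have [] := supp_Tr_dimension r01 s0 mr.
move=> r' [r'01 dim _]; have [s' [/andP[s'1 _] mr']] := moran_exponent_exists r'01.
have [dim' _] := supp_Tr_dimension r'01 (lt_trans ltr01 s'1) mr'.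
have ss' : s' = s by move: dim; rewrite dim' => -[].
by apply: (moran_inj s1) => //; rewrite -ss'.
Qed.
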